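(* Let $K\subset\mathbb{R}^n$ be an isotone projection cone generated by a linearly independent system $\{b_i\}_{i=1}^n$ with the associated dual system $\{u_i\}_{i=1}^n$. Let $F:\mathbb{R}^m\times\mathbb{R}^n\to\mathbb{R}^n$ be continuously differentiable, let $S$ be the solution mapping $$S(p)=\{x\in K\mid F(p,x)\in-K^\circ,\ \langle x,F(p,x)\rangle=0\},\qquad p\in\mathbb{R}^m,$$ and let $(\bar p,\bar x)\in\operatorname{gph}S$. Assume that $F'_p(\bar p,\bar x)$ is surjective. Write $I^+:=I^+_{\bar x-F(\bar p,\bar x)}$, $I^-:=I^-_{\bar x-F(\bar p,\bar x)}$, $I^\bullet:=I^\bullet_{\bar x-F(\bar p,\bar x)}$. Then $S$ has the Aubin property around $(\bar p,\bar x)$ if and only if for all $I,J\subset I^\bullet$ with $I\cap J=\emptyset$ the following implication holds for every $v^*\in\mathbb{R}^n$: $$\left.\begin{array}{ll}\langle(F'_x(\bar p,\bar x))^Tv^*,b_i\rangle=0 & \forall i\in I^+\cup I,\\ \langle(F'_x(\bar p,\bar x))^Tv^*,b_i\rangle\le0,\ \ \langle v^*,u_i\rangle\le0 & \forall i\in I^\bullet\setminus(I\cup J),\\ \langle v^*,u_i\rangle=0 & \forall i\in I^-\cup J\end{array}\right\}\ \Longrightarrow\ v^*=0.$$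
   Context: $N=\{1,\ldots,n\}$ with $n\ge1$. For linearly independent $b_1,\ldots,b_n\in\mathbb{R}^n$, the cone generated by them is $K=\{\sum_{i=1}^n\alpha_i b_i\mid \alpha_i\ge 0\}$; the associated dual system $u_1,\ldots,u_n$ is determined by $\langle u_j,b_i\rangle=-\delta_{ij}$ (Kronecker delta). $P_K$ denotes the Euclidean metric projection onto $K$. $K$ is an isotone projection cone if for all $x,y$ with $y-x\in K$ one has $P_K(y)-P_K(x)\in K$; it is known that this is equivalent to $\langle u_j,u_k\rangle\le 0$ for all $j\neq k$. The polar cone is $K^\circ=\{y\mid\langle y,x\rangle\le0\ \forall x\in K\}$. $F'_p$ and $F'_x$ denote the partial Jacobians of $F$ with respect to $p$ and $x$. Index sets: it is known that for every $x\in\mathbb{R}^n$ there is a unique subset $I\subset N$ such that $x=\sum_{i\in N\setminus I}\alpha_i b_i+\sum_{j\in I}\beta_j u_j$ with $\beta_j>0$ for all $j\in I$ and $\alpha_i\ge0$ for all $i\in N\setminus I$ (the coefficients are then unique, and $P_K(x)=\sum_{i\in N\setminus I}\alpha_i b_i$). With this $I$, define $I_x^+:=\{i\in N\setminus I\mid\alpha_i>0\}$, $I_x^\bullet:=\{i\in N\setminus I\mid\alpha_i=0\}$, $I_x^-:=I$. Aubin property: with $\mathbb{B}_r(\cdot)$ the closed ball of radius $r$ and $\mathbb{B}$ the closed unit ball, a set-valued map $\Phi:\mathbb{R}^s\rightrightarrows\mathbb{R}^n$ has the Aubin property around $(\bar y,\bar x)\in\operatorname{gph}\Phi$ if there exist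 $\kappa>0$ and $r>0$ such that $\Phi(y_1)\cap\mathbb{B}_r(\bar x)\subset\Phi(y_2)+\kappa\|y_1-y_2\|\mathbb{B}$ for all $y_1,y_2\in\mathbb{B}_r(\bar y)$. *)

(* Defs.v *)
From HB Require Import structures.
From mathcomp Require Import all_boot all_order all_algebra.
From mathcomp Require Import all_classical all_reals all_analysis.

Set Implicit Arguments.
Unset Strict Implicit.
Unset Printing Implicit Defensive.

Import Order.TTheory GRing.Theory Num.Theory.
Import numFieldNormedType.Exports.

Local Open Scope classical_set_scope.
Local Open Scope ring_scope.

(* The library norm on 'rV[R]_n is the sup norm, so the Euclidean inner
   product, norm and closed balls are introduced here. The library topology
   (used for differentiability and continuity) is the same for both norms. *)
Section Euclidean.
Variables (R : realType) (n : nat).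
Implicit Types (x y : 'rV[R]_n) (A : set 'rV[R]_n).

Definition dot x y : R := \sum_(i < n) x 0 i * y 0 i.

Definition enorm x : R := Num.sqrt (dot x x).

Definition eball x (r : R) : set 'rV[R]_n := [set y | enorm (y - x) <= r].

Definition is_proj A x z : Prop :=
  A z /\ forall y, A y -> enorm (x - z) <= enorm (x - y).

(* The metric projection; the default value 0 is only taken when there is no
   nearest point, which does not happen for a nonempty closed set. *)
Definition proj A x : 'rV[R]_n := xget 0 [set z | is_proj A x z].

Definition isotone_projection (A : set 'rV[R]_n) : Prop :=
  forall x y, A (y - x) -> A (proj A y - proj A x).

Definition polar A : set 'rV[R]_n := [set y | forall x, A x -> dot y x <= 0].

End Euclidean.

Section GeneratedCone.
Variables (R : realType) (n : nat).
Implicit Types (b u : 'I_n -> 'rV[R]_n) (x : 'rV[R]_n).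

Definition lin_indep b : Prop := free [seq b i | i <- enum 'I_n].

Definition cone b : set 'rV[R]_n :=
  [set x | exists2 a : 'I_n -> R,
     forall i, 0 <= a i & x = \sum_(i < n) a i *: b i].

Definition dual_system b u : Prop :=
  forall i j, dot (u j) (b i) = - (i == j)%:R.

Definition index_rep b u x (I : {set 'I_n}) (a c : 'I_n -> R) : Prop :=
  [/\ x = \sum_(i | i \notin I) a i *: b i + \sum_(j | j \in I) c j *: u j,
      forall j, j \in I -> 0 < c j
    & forall i, i \notin I -> 0 <= a i].

(* For a linearly independent b with dual system u, every x has exactly one
   representation (the values of a on I and of c outside I being irrelevant),
   so the existential quantifiers below merely refer to it. *)
Definition Iplus b u x : {set 'I_n} :=
  [set i | `[< exists I a c,
     [/\ index_rep b u x I a c, i \notin I & 0 < a i] >]]%SET.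

Definition Ibullet b u x : {set 'I_n} :=
  [set i | `[< exists I a c,
     [/\ index_rep b u x I a c, i \notin I & a i = 0] >]]%SET.

Definition Iminus b u x : {set 'I_n} :=
  [set i | `[< exists I a c, index_rep b u x I a c /\ i \in I >]]%SET.

End GeneratedCone.

(* Vectors are rows and 'd f x v = v *m 'J f x, so 'J f x is the transpose of
   the usual Jacobian matrix; the adjoint of v |-> v *m J is w |-> w *m J^T. *)
Definition cont_diff (R : realType) (m n : nat)
    (f : 'rV[R]_m -> 'rV[R]_n) : Prop :=
  (forall x, differentiable f x) /\ continuous (fun x => 'J f x).

Section Parametric.
Variables (R : realType) (m n : nat).
Variable F : 'rV[R]_m -> 'rV[R]_n -> 'rV[R]_n.

(* R^m x R^n is identified with R^(m + n). *)
Definition cont_diff2 : Prop :=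
  cont_diff (fun z : 'rV[R]_(m + n) => F (lsubmx z) (rsubmx z)).

Definition jac_p (p : 'rV[R]_m) (x : 'rV[R]_n) : 'M[R]_(m, n) :=
  'J (fun q => F q x) p.

Definition jac_x (p : 'rV[R]_m) (x : 'rV[R]_n) : 'M[R]_(n, n) := 'J (F p) x.

Definition solution_map (K : set 'rV[R]_n) (p : 'rV[R]_m) : set 'rV[R]_n :=
  [set x | [/\ K x, polar K (- F p x) & dot x (F p x) = 0]].

End Parametric.

Definition aubin (R : realType) (s n : nat) (Phi : 'rV[R]_s -> set 'rV[R]_n)
    (ybar : 'rV[R]_s) (xbar : 'rV[R]_n) : Prop :=
  exists kappa r : R, [/\ 0 < kappa, 0 < r &
    forall y1 y2, eball ybar r y1 -> eball ybar r y2 ->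
      Phi y1 `&` eball xbar r `<=`
      [set x + (kappa * enorm (y1 - y2)) *: w | x in Phi y2 & w in eball 0 1]].

(* Main.v *)
Require Import Defs.
From HB Require Import structures.
From mathcomp Require Import all_boot all_order all_algebra.
From mathcomp Require Import all_classical all_reals all_analysis.
From mathcomp Require Import ring lra.

(** In the coordinates [a] of [x = sum a_i b_i] and [s_i = <F(p, x), b_i>], the
    problem is the complementarity system [a >= 0], [s >= 0], [a_i s_i = 0], with
    [s = f p a] for a map [f]. Call multiplier the coordinate vector of a [v]
    satisfying the premises of the implication for some [I] and [J].

    If there is no nonzero multiplier, let [a1] solve the system for [p1] and
    minimize, over complementary pairs [(a, s)] near [(a1, f p1 a1)], the
    residual [|f p2 a - s|] plus a small multiple of the distance to that pair.
    If the residual vector [y] at the minimizer were not zero, then testing with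
    moves of a single coordinate of [a] or [s] would make [- y] an approximate
    multiplier, which compactness of the sphere excludes. So the residual
    vanishes, at a distance from [a1] of the order of [|p1 - p2|].

    If there is a multiplier [w <> 0], the reference pair can be shifted so that
    the indices of [I] get [a_i > 0] and those of [J] get [s_i > 0]; the shifted
    pair solves the system for a parameter [p1] near [pbar], since [f] is open
    in [p]. Then move [p1] to [p1 + h q], where [q] is mapped to [- w] by the
    derivative in [p]: a solution at distance [O(h)] would have
    [0 <= <w, f p2 a2 - f p1 a1> <= - h |w|^2 + o(h)]. *)

Set Implicit Arguments.
Unset Strict Implicit.
Unset Printing Implicit Defensive.

Import Order.TTheory GRing.Theory Num.Theory.
Import numFieldNormedType.Exports.

Local Open Scope ring_scope.

(** * Euclidean and sup norms, bounds for linear maps, and a minimization principle *)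

Section Norms.
Local Open Scope classical_set_scope.
Variable R : realType.

Lemma entry_le_norm m n (x : 'M[R]_(m, n)) i j : `|x i j| <= `|x|.
Proof.
rewrite [leRHS]/Num.norm /= mx_normrE.
exact: (le_bigmax _ (fun ij : 'I_m * 'I_n => `|x ij.1 ij.2|) (i, j)).
Qed.

Lemma norm_le_entries m n (x : 'M[R]_(m, n)) (c : R) :
  0 <= c -> (forall i j, `|x i j| <= c) -> `|x| <= c.
Proof.
move=> c0 xc; rewrite [leLHS]/Num.norm /= mx_normrE.
by apply/bigmax_leP; split=> // -[i j] _; exact: xc.
Qed.

Lemma dotC n (x y : 'rV[R]_n) : dot x y = dot y x.
Proof. by apply: eq_bigr => i _; rewrite mulrC. Qed.

Lemma dotDl n (x y z : 'rV[R]_n) : dot (x + y) z = dot x z + dot y z.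
Proof. by rewrite -big_split; apply: eq_bigr => i _; rewrite mxE mulrDl. Qed.

Lemma dotZl n k (x y : 'rV[R]_n) : dot (k *: x) y = k * dot x y.
Proof. by rewrite mulr_sumr; apply: eq_bigr => i _; rewrite mxE mulrA. Qed.

Lemma dotNl n (x y : 'rV[R]_n) : dot (- x) y = - dot x y.
Proof. by rewrite -scaleN1r dotZl mulN1r. Qed.

Lemma dotDr n (x y z : 'rV[R]_n) : dot x (y + z) = dot x y + dot x z.
Proof. by rewrite !(dotC x) dotDl. Qed.

Lemma dotZr n k (x y : 'rV[R]_n) : dot x (k *: y) = k * dot x y.
Proof. by rewrite !(dotC x) dotZl. Qed.

Lemma dotNr n (x y : 'rV[R]_n) : dot x (- y) = - dot x y.
Proof. by rewrite !(dotC x) dotNl. Qed.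

Lemma dot0l n (x : 'rV[R]_n) : dot 0 x = 0.
Proof. by rewrite -(scale0r x) dotZl mul0r. Qed.

Lemma dot_suml n (I : finType) (P : pred I) (g : I -> 'rV[R]_n) y :
  dot (\sum_(i | P i) g i) y = \sum_(i | P i) dot (g i) y.
Proof.
elim/big_rec2 : _ => [|i a c _ <-]; first exact: dot0l.
by rewrite dotDl.
Qed.

Lemma dotE n (x y : 'rV[R]_n) : dot x y = (x *m y^T) 0 0.
Proof. by rewrite mxE; apply: eq_bigr => i _; rewrite mxE. Qed.

Lemma dot_mulmx m n (x : 'rV[R]_m) (y : 'rV[R]_n) (M : 'M[R]_(m, n)) :
  dot (x *m M) y = dot x (y *m M^T).
Proof. by rewrite !dotE trmx_mul trmxK mulmxA. Qed.

Lemma dot_ge0 n (x : 'rV[R]_n) : 0 <= dot x x.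
Proof. by apply: sumr_ge0 => i _; rewrite -expr2 sqr_ge0. Qed.

Lemma dot_eq0 n (x : 'rV[R]_n) : dot x x = 0 -> x = 0.
Proof.
move/eqP; rewrite psumr_eq0 => [/allP x0|i _]; last by rewrite -expr2 sqr_ge0.
apply/rowP => i; rewrite mxE.
by have := x0 i (mem_index_enum _); rewrite -expr2 sqrf_eq0 => /eqP.
Qed.

Lemma dot_le_norm n (x y : 'rV[R]_n) : `|dot x y| <= n%:R * (`|x| * `|y|).
Proof.
apply: le_trans (ler_norm_sum _ _ _) _.
rewrite -[X in X%:R * _]card_ord mulr_natl -sumr_const.
by apply: ler_sum => i _; rewrite normrM ler_pM // entry_le_norm.
Qed.

Lemma sqr_enorm n (x : 'rV[R]_n) : enorm x ^+ 2 = dot x x.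
Proof. by rewrite sqr_sqrtr // dot_ge0. Qed.

Lemma enorm_ge0 n (x : 'rV[R]_n) : 0 <= enorm x.
Proof. exact: sqrtr_ge0. Qed.

Lemma norm_le_enorm n (x : 'rV[R]_n) : `|x| <= enorm x.
Proof.
apply: norm_le_entries => [|i j]; first exact: enorm_ge0.
rewrite ord1 -sqrtr_sqr ler_wsqrtr // expr2 /dot (bigD1 j) //= lerDl.
by apply: sumr_ge0 => k _; rewrite -expr2 sqr_ge0.
Qed.

(** A crude constant suffices; [n.+1] rather than [n] keeps it positive for [n = 0], so that one may
    divide by it. *)
Lemma enorm_le_norm n (x : 'rV[R]_n) : enorm x <= n.+1%:R * `|x|.
Proof.
rewrite -(ler_pXn2r (n := 2)) // ?nnegrE ?enorm_ge0 ?mulr_ge0 //.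
rewrite sqr_enorm (le_trans (ler_norm _)) // (le_trans (dot_le_norm _ _)) //.
rewrite exprMn -expr2 ler_wpM2r ?exprn_ge0 //.
by rewrite -natrX ler_nat (leq_trans (leqnSn n)) // leq_pmulr.
Qed.

Lemma enorm_eq0 n (x : 'rV[R]_n) : enorm x = 0 -> x = 0.
Proof. by move=> x0; apply: dot_eq0; rewrite -sqr_enorm x0 expr0n. Qed.

Lemma mulmx_norm_le m n (x : 'rV[R]_m) (M : 'M[R]_(m, n)) :
  `|x *m M| <= m%:R * `|M| * `|x|.
Proof.
apply: norm_le_entries => [|i j]; first by rewrite !mulr_ge0.
rewrite mxE; apply: le_trans (ler_norm_sum _ _ _) _.
rewrite -mulrA -[X in X%:R * _]card_ord mulr_natl -sumr_const.
by apply: ler_sum => k _; rewrite normrM mulrC ler_pM // entry_le_norm.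
Qed.

Lemma mulmx_bound m n (A : 'M[R]_(m, n)) :
  exists2 k : R, 0 < k & forall x : 'rV[R]_m, `|x *m A| <= k * `|x|.
Proof.
exists (m%:R * `|A| + 1); first by rewrite ltr_wpDl // mulr_ge0.
move=> x; apply: le_trans (mulmx_norm_le _ _) _.
by rewrite ler_wpM2r // lerDl.
Qed.

Lemma mulmx_continuous m n (M : 'M[R]_(m, n)) :
  continuous (fun x : 'rV[R]_m => x *m M).
Proof.
move=> x; apply/(@cvgrPdist_le _ _ _ (nbhs x)) => e e0.
have [k k0 kM] := mulmx_bound M.
have /cvgrPdist_le xy : y @[y --> x] --> x by exact: cvg_id.
near=> y; rewrite -mulmxBl; apply: le_trans (kM _) _.
rewrite mulrC -ler_pdivlMr //.
by near: y; apply: xy; exact: divr_gt0.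
Unshelve. all: by end_near. Qed.

(** Its later instances are the insertions [q |-> (q, x)] and [y |-> (p, y)] into the product
    space. *)
Lemma affine_mx_diff m n (M : 'M[R]_(m, n)) (c : 'rV[R]_n) (x : 'rV[R]_m) :
  is_diff x (fun y : 'rV[R]_m => y *m M + c) (mulmxr M).
Proof.
have cM : continuous (mulmxr M : 'rV[R]_m -> 'rV[R]_n) := @mulmx_continuous m n M.
rewrite -[X in is_diff_def _ _ X](addr0 (mulmxr M : 'rV[R]_m -> 'rV[R]_n)).
apply: (@is_diffD _ _ _ (mulmxr M) (cst c)).
split; first exact: linear_differentiable.
exact: diff_lin.
Qed.

Lemma row_mx_norm m n (x : 'rV[R]_m) (y : 'rV[R]_n) :
  `|row_mx x y| = Num.max `|x| `|y|.
Proof.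
apply/eqP; rewrite eq_le ge_max; apply/andP; split.
  apply: norm_le_entries => [|i j]; first by rewrite le_max normr_ge0.
  rewrite -(splitK j); case: (fintype.split j) => k /=.
    by rewrite row_mxEl le_max entry_le_norm.
  by rewrite row_mxEr le_max entry_le_norm orbT.
apply/andP; split; apply: norm_le_entries => // i j.
  by rewrite -(row_mxEl x y); exact: entry_le_norm.
by rewrite -(row_mxEr x y); exact: entry_le_norm.
Qed.

Lemma distance_continuous (T : topologicalType) (V : normedModType R)
  (g : T -> V) c : continuous g -> continuous (fun x => `|g x - c|).
Proof.
move=> cg x; apply: cvg_norm.
by apply: cvgB; [exact: cg|exact: cvg_cst].
Qed.

(* As in Ekeland's principle, [x] minimizes [f + eps * |. - x0|]. *)
Lemma zero_of_descent (V : normedModType R) (A : set V) (f : V -> R) x0 eps :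
  compact A -> continuous f -> A x0 -> 0 <= eps ->
  (forall x, A x -> f x != 0 -> eps * `|x - x0| <= f x0 - f x ->
     exists2 y, A y & f y < f x - eps * `|y - x|) ->
  exists x, [/\ A x, f x = 0 & eps * `|x - x0| <= f x0].
Proof.
move=> cA cf Ax0 eps0 desc.
have cg : continuous (fun x => f x + eps * `|x - x0|).
  move=> x; apply: cvgD; first exact: cf.
  apply: cvgM; first exact: cvg_cst.
  by apply: (@distance_continuous _ _ id) => y; exact: cvg_id.
have [|x /set_mem Ax xmin] := @compact_EVT_min _ _ _ A _ cA
    (continuous_subspaceT cg); first by exists x0.
have := xmin _ (mem_set Ax0); rewrite subrr normr0 mulr0 addr0 => fx.
have [f0|/desc] := eqVneq (f x) 0; first by exists x; split => //; rewrite f0 add0r in fx.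
case=> //; first lra.
move=> y /mem_set/xmin gy fy.
have : eps * `|y - x0| <= eps * (`|y - x| + `|x - x0|).
  by rewrite ler_wpM2l // -{1}(subrK x y) -addrA ler_normD.
lra.
Qed.

End Norms.

(** * Strict differentiability and openness in the parameter *)

Section StrictDifferentiability.
Local Open Scope classical_set_scope.
Variable R : realType.

(** Strict differentiability in the pair of variables: both points of the increment vary near the
    base point, and the linear map is the same for all of them. *)
Definition strict_diff2 m n k (f : 'rV[R]_m -> 'rV[R]_n -> 'rV[R]_k) p0 x0
    (P : 'M[R]_(m, k)) (M : 'M[R]_(n, k)) : Prop :=
  forall d : R, 0 < d -> exists2 r : R, 0 < r & forall p1 p2 x1 x2,
    `|p1 - p0| <= r -> `|p2 - p0| <= r -> `|x1 - x0| <= r -> `|x2 - x0| <= r ->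
    `|f p1 x1 - f p2 x2 - ((p1 - p2) *m P + (x1 - x2) *m M)|
      <= d * (`|p1 - p2| + `|x1 - x2|).

Lemma strict_diff2_lipschitz m n k (f : 'rV[R]_m -> 'rV[R]_n -> 'rV[R]_k)
    p0 x0 P M : strict_diff2 f p0 x0 P M ->
  exists L r : R, [/\ 0 < L, 0 < r & forall p1 p2 x1 x2,
    `|p1 - p0| <= r -> `|p2 - p0| <= r -> `|x1 - x0| <= r -> `|x2 - x0| <= r ->
    `|f p1 x1 - f p2 x2| <= L * (`|p1 - p2| + `|x1 - x2|)].
Proof.
move=> /(_ 1 ltr01)[r r0 fr].
exists (1 + m%:R * `|P| + n%:R * `|M|), r; split => //.
move=> p1 p2 x1 x2 hp1 hp2 hx1 hx2.
have h1 := fr _ _ _ _ hp1 hp2 hx1 hx2.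
set l := (p1 - p2) *m P + _ in h1.
have hP := mulmx_norm_le (p1 - p2) P; have hM := mulmx_norm_le (x1 - x2) M.
have hl : `|l| <= _ := ler_normD _ _.
have : `|f p1 x1 - f p2 x2| <= `|f p1 x1 - f p2 x2 - l| + `|l|.
  by rewrite -{1}(subrK l (_ - _)) ler_normD.
have : 0 <= m%:R * `|P| * `|x1 - x2| by rewrite !mulr_ge0.
have : 0 <= n%:R * `|M| * `|p1 - p2| by rewrite !mulr_ge0.
nra.
Qed.

Lemma norm_ball_compact n (x0 : 'rV[R]_n) (r : R) :
  compact [set x | `|x - x0| <= r].
Proof.
apply: bounded_closed_compact.
  exists (r + `|x0|); split; first exact: num_real.
  move=> e re x /= xr; apply: le_trans (ltW re).
  by rewrite -{1}(subrK x0 x) (le_trans (ler_normD _ _)) // lerD2r.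
apply: (@closed_comp _ _ (fun x : 'rV[R]_n => `|x - x0|) [set x | x <= r]).
  by move=> x _; apply: (@distance_continuous _ _ _ id) => y; exact: cvg_id.
exact: closed_le.
Qed.

(** A Graves-type theorem. The right inverse [A] of [P] provides Newton steps in [p] alone, with [x]
    fixed. Minimizing the residual plus [e] times the distance to [p0] then yields a zero, and the
    bound on the penalty is the linear estimate. *)
Lemma strict_diff2_open m n k (f : 'rV[R]_m -> 'rV[R]_n -> 'rV[R]_k)
    p0 x0 P M (A : 'M[R]_(k, m)) : strict_diff2 f p0 x0 P M -> A *m P = 1%:M ->
  (forall x, continuous (f ^~ x)) ->
  exists C r : R, [/\ 0 < C, 0 < r & forall x s,
    `|x - x0| <= r -> `|s - f p0 x0| <= r ->
    exists2 p, f p x = s & `|p - p0| <= C * (`|x - x0| + `|s - f p0 x0|)].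
Proof.
move=> sf AP cf.
have [L [r1 [L0 r10 fL]]] := strict_diff2_lipschitz sf.
have [kA kA0 kAP] := mulmx_bound A.
(* A Newton step for the residual [y] has length at most [kA * |y|]. With this [e] it costs at most
   [|y| / 4] in the penalty and leaves a residual of at most [|y| / 4]. *)
pose e : R := (4 * kA)^-1.
have e0 : 0 < e by rewrite invr_gt0 mulr_gt0.
have ekA : e * kA = 4^-1 by rewrite /e invfM mulfVK // gt_eqF.
have [r2 r20 fr] := sf e e0.
pose r0 := Num.min r1 r2.
have r00 : 0 < r0 by rewrite lt_min r10.
have [r01 r02] : r0 <= r1 /\ r0 <= r2 by rewrite /r0 !ge_min !lexx orbT.
(* Makes the residual at [p0] at most [e * r0 / 2], so that candidates stay within [r0 / 2] of [p0]
   and a Newton step from them does not leave the ball. *)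
pose r := Num.min r0 (e * r0 / (4 * (L + 1))).
have L1 : 0 < L + 1 by rewrite addr_gt0.
have r_gt0 : 0 < r by rewrite lt_min r00 divr_gt0 ?mulr_gt0.
have [rr0 rL] : r <= r0 /\ r <= e * r0 / (4 * (L + 1)).
  by split; rewrite ge_min lexx ?orbT.
rewrite ler_pdivlMr ?mulr_gt0 // in rL.
exists ((L + 1) / e), r; split => //.
  exact: divr_gt0.
move=> x s xr sr.
have fp0 : `|f p0 x - s| <= (L + 1) * (`|x - x0| + `|s - f p0 x0|).
  have h : `|f p0 x - f p0 x0| <= L * (`|p0 - p0| + `|x - x0|).
    by apply: fL; rewrite ?subrr ?normr0; lra.
  rewrite subrr normr0 add0r in h.
  have : `|f p0 x - s| <= `|f p0 x - f p0 x0| + `|s - f p0 x0|.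
    by rewrite -(subrKA (f p0 x0)) (le_trans (ler_normD _ _)) // (distrC s).
  have : 0 <= L * `|s - f p0 x0| by rewrite mulr_ge0 // ltW.
  have : 0 <= `|x - x0| by [].
  lra.
have fr0 : `|f p0 x - s| <= e * r0 / 2.
  apply: le_trans fp0 _.
  have : (L + 1) * (`|x - x0| + `|s - f p0 x0|) <= (L + 1) * (r + r).
    by rewrite ler_pM2l ?addr_gt0 // lerD.
  nra.
have [|||||p [pr fp ep]] := @zero_of_descent R _ [set p | `|p - p0| <= r0]
    (fun p => `|f p x - s|) p0 e.
- exact: norm_ball_compact.
- exact: distance_continuous.
- by rewrite /= subrr normr0 ltW.
- exact: ltW.
- move=> p /= pr; set y := f p x - s => y0 ep.
  (* One Newton step [- y *m A] reduces the residual by a fixed factor. *)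
  have hy0 : 0 < `|y| by rewrite lt_neqAle eq_sym y0 /=.
  have pr2 : `|p - p0| <= r0 / 2.
    by rewrite -(ler_pM2l e0); lra.
  have yr : e * (kA * `|y|) <= e * (r0 / 4).
    rewrite mulrA ekA; have : 0 <= e * `|p - p0| by rewrite mulr_ge0 // ltW.
    lra.
  rewrite (ler_pM2l e0) in yr.
  pose p' := p - y *m A.
  have p'p : `|p' - p| <= kA * `|y| by rewrite addrAC subrr add0r normrN kAP.
  have p'r : `|p' - p0| <= r0.
    have : `|p' - p0| <= `|p' - p| + `|p - p0|.
      by rewrite -{1}(subrK p p') -addrA ler_normD.
    lra.
  exists p' => //.
  have h : `|f p' x - f p x - ((p' - p) *m P + (x - x) *m M)|
      <= e * (`|p' - p| + `|x - x|) by apply: fr; lra.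
  rewrite subrr normr0 mul0mx !addr0 in h.
  have eq : (p' - p) *m P = - y.
    by rewrite addrAC subrr add0r mulNmx -mulmxA AP mulmx1.
  rewrite eq opprK in h.
  rewrite (_ : f p' x - s = f p' x - f p x + y); last by rewrite subrKA.
  have : e * `|p' - p| <= e * (kA * `|y|) by rewrite ler_pM2l.
  rewrite mulrA ekA; lra.
exists p; first by apply/eqP; rewrite -subr_eq0 -normr_eq0 fp.
by rewrite mulrAC ler_pdivlMr // mulrC (le_trans ep).
Qed.
End StrictDifferentiability.

(** * The complementarity system and its multipliers *)

Section Complementarity.
Local Open Scope classical_set_scope.
Variable R : realType.

Definition ncp m n (f : 'rV[R]_m -> 'rV[R]_n -> 'rV[R]_n) p : set 'rV[R]_n :=
  [set a : 'rV[R]_n | forall i, [/\ 0 <= a 0 i, 0 <= f p a 0 i & a 0 i * f p a 0 i = 0]].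

(* The Aubin property with respect to the library's sup norms. *)
Definition lip_like m n (S : 'rV[R]_m -> set 'rV[R]_n) p0 x0 : Prop :=
  exists k r : R, [/\ 0 < k, 0 < r & forall p1 p2 x1,
    `|p1 - p0| <= r -> `|p2 - p0| <= r -> S p1 x1 -> `|x1 - x0| <= r ->
    exists2 x2, S p2 x2 & `|x1 - x2| <= k * `|p1 - p2|].

(** Yields a radius within which no positive coordinate can drop to 0; the value 1 is taken if there
    is none. *)
Lemma lower_bound_of_positive (I : finType) (v : I -> R) :
  exists2 r : R, 0 < r & forall i, 0 < v i -> r <= v i.
Proof.
exists (\big[Num.min/1]_(i | 0 < v i) v i); first exact: lt_bigmin.
by move=> i vi; apply: bigmin_le_cond.
Qed.

Lemma sum_continuous (T : topologicalType) (I : Type) (r : seq I)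
    (g : I -> T -> R) :
  (forall i, continuous (g i)) -> continuous (fun x => \sum_(i <- r) g i x).
Proof.
move=> cg; elim: r => [|i r IH].
  rewrite (_ : (fun _ => _) = fun=> 0); first exact: cst_continuous.
  by apply/funext => x; rewrite big_nil.
rewrite (_ : (fun _ => _) = fun x => g i x + \sum_(j <- r) g j x).
  by move=> x; apply: cvgD; [exact: cg|exact: IH].
by apply/funext => x; rewrite big_cons.
Qed.

(** The sum of the [t i] has a positive minimum on the compact unit sphere, so one summand exceeds a
    fixed fraction of it; homogeneity extends this to all [w]. *)
Lemma homogeneous_lower_bound n (t : 'I_n -> 'rV[R]_n -> R) :
  (forall i, continuous (t i)) -> (forall i w, 0 <= t i w) ->
  (forall i k w, 0 <= k -> t i (k *: w) = k * t i w) ->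
  (forall w, (forall i, t i w = 0) -> w = 0) ->
  exists2 c : R, 0 < c & forall w, w != 0 -> exists i, c * `|w| < t i w.
Proof.
move=> ct t0 tZ tw.
pose A := [set w : 'rV[R]_n | `|w| = 1].
have scaleA (w : 'rV[R]_n) : w != 0 -> A (`|w|^-1 *: w).
  by move=> w0; rewrite /A /= normrZ normfV normr_id mulVf // normr_eq0.
(* If the sphere is empty, which happens for [n = 0], there is no nonzero [w] and any [c] will
   do. *)
have [[w1 Aw1]|A0] := pselect (A !=set0); last first.
  by exists 1 => // w /scaleA Aw; case: A0; exists (`|w|^-1 *: w).
have cA : compact A.
  apply: subclosed_compact (@norm_ball_compact R n 0 1) _.
    apply: (@closed_comp _ _ (fun x : 'rV[R]_n => `|x|) [set x | x = 1]).
      by move=> x _; exact: norm_continuous.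
    exact: closed_eq.
  by move=> w; rewrite /A /= subr0 => ->.
have [|w0 /set_mem Aw0 wmin] := compact_EVT_min _ cA
  (continuous_subspaceT (sum_continuous (r := index_enum 'I_n) ct)).
  by exists w1.
have ge0_sum w : 0 <= \sum_i t i w by apply: sumr_ge0.
set mu := \sum_i t i w0 in wmin.
have mu0 : 0 < mu.
  rewrite lt_neqAle ge0_sum eq_sym andbT psumr_eq0 //.
  apply/negP => /allP t_eq0.
  have w00 : w0 = 0.
    by apply: tw => i; exact/eqP/t_eq0/mem_index_enum.
  by move: Aw0; rewrite /A /= w00 normr0 => /eqP; rewrite eq_sym oner_eq0.
have n1 : 0 < n.+1%:R :> R by [].
(* If every [t i] were at most this number, their sum would be at most [n / (n + 1)] times [mu],
   strictly below the minimum. *)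
exists (mu / n.+1%:R); first exact: divr_gt0.
move=> w w_neq0; apply/not_existsP => tle.
have {}tle i : t i (`|w|^-1 *: w) <= mu / n.+1%:R.
  have := tle i; rewrite tZ ?invr_ge0 // ler_pdivrMl ?normr_gt0 // mulrC.
  by rewrite leNgt => /negP.
have := wmin _ (mem_set (scaleA _ w_neq0)); apply/negP; rewrite -ltNge.
apply: le_lt_trans (ler_sum _ (fun i _ => tle i)) _.
rewrite sumr_const card_ord -[_ *+ n]mulr_natr -mulrA gtr_pMr // mulrC.
by rewrite ltr_pdivrMr // mul1r ltr_nat.
Qed.

Lemma continuous_norm_comp (T : topologicalType) (g : T -> R) :
  continuous g -> continuous (fun x => `|g x|).
Proof. by move=> cg x; apply: cvg_norm; exact: cg. Qed.

(** The function is the last branch of [multiplier_gap], where neither [a] nor [s] is positive. *)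
Lemma continuous_min_max_gap (T : topologicalType) (g h : T -> R) :
  continuous g -> continuous h -> continuous (fun x =>
    Num.min (Num.min `|g x| `|h x|) (Num.max (Num.max (g x) (- h x)) 0)).
Proof.
move=> cg ch x.
have ng := continuous_norm_comp cg (x := x).
have nh := continuous_norm_comp ch (x := x).
have Nh : {for x, continuous (fun x => - h x)} by apply: cvgN; exact: ch.
have c0 : {for x, continuous (fun=> 0 : R)} by exact: cvg_cst.
exact: (continuous_min (continuous_min ng nh)
  (continuous_max (continuous_max (cg x) Nh) c0)).
Qed.

Lemma entry_continuous n (i : 'I_n) : continuous (fun w : 'rV[R]_n => w 0 i).
Proof. exact: coord_continuous. Qed.

Lemma mulmx_entry_continuous m n (M : 'M[R]_(m, n)) i :
  continuous (fun w : 'rV[R]_m => (w *m M) 0 i).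
Proof.
move=> w; have cM := @mulmx_continuous R m n M w.
exact: (continuous_comp cM (@entry_continuous n i _)).
Qed.

(* Vanishes for every [i] exactly when [w] is a multiplier, i.e. violates
   [no_multiplier] below; it is positively homogeneous in [w]. *)
Definition multiplier_gap n (a s : 'rV[R]_n) (M : 'M[R]_n) i (w : 'rV[R]_n) : R :=
  if 0 < a 0 i then `|(w *m M^T) 0 i| else
  if 0 < s 0 i then `|w 0 i| else
  Num.min (Num.min `|(w *m M^T) 0 i| `|w 0 i|)
    (Num.max (Num.max ((w *m M^T) 0 i) (- w 0 i)) 0).

(* The three alternatives on a doubly inactive index say that it belongs to [I],
   to [J] or to neither. *)
Definition no_multiplier n (a s : 'rV[R]_n) (M : 'M[R]_n) : Prop :=
  forall w : 'rV[R]_n,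
    (forall i, 0 < a 0 i -> (w *m M^T) 0 i = 0) ->
    (forall i, 0 < s 0 i -> w 0 i = 0) ->
    (forall i, ~~ (0 < a 0 i) -> ~~ (0 < s 0 i) ->
       [\/ (w *m M^T) 0 i = 0, w 0 i = 0 |
           (w *m M^T) 0 i <= 0 /\ 0 <= w 0 i]) ->
    w = 0.

Lemma no_multiplier_gap n (a s : 'rV[R]_n) M :
  (forall i, a 0 i * s 0 i = 0) -> no_multiplier a s M ->
  exists2 c : R, 0 < c &
    forall w, w != 0 -> exists i, c * enorm w < multiplier_gap a s M i w.
Proof.
move=> as0 nm.
have [||||c c0 cw] := @homogeneous_lower_bound n (multiplier_gap a s M).
- move=> i; rewrite /multiplier_gap.
  have cg := @mulmx_entry_continuous n n M^T i.
  have cw := @entry_continuous n i.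
  case: (0 < a 0 i); first exact: continuous_norm_comp.
  case: (0 < s 0 i); first exact: continuous_norm_comp.
  exact: continuous_min_max_gap.
- move=> i w; rewrite /multiplier_gap; case: ifP => // _; case: ifP => // _.
  by rewrite !le_min !normr_ge0 le_max lexx orbT.
- move=> i k w k0; rewrite /multiplier_gap -scalemxAl.
  have Zi (x : 'rV[R]_n) : (k *: x) 0 i = k * x 0 i by rewrite mxE.
  rewrite !Zi !normrM (ger0_norm k0); case: ifP => // _; case: ifP => // _.
  by rewrite !minr_pMr // !maxr_pMr // mulrN mulr0.
- move=> w gap0; apply: nm => i.
  + by move=> ai; apply/normr0_eq0; have := gap0 i; rewrite /multiplier_gap ai.
  (* Complementarity rules out the branch [0 < a 0 i], so the gap is that of [w]. *)
  + move=> si; have := gap0 i; rewrite /multiplier_gap si.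
    case: ifP => [ai|_]; last exact: normr0_eq0.
    by move/eqP: (as0 i); rewrite mulf_eq0 !gt_eqF.
  + move=> /negPf ai /negPf si; have := gap0 i; rewrite /multiplier_gap ai si.
    set g := (w *m _) 0 i.
    rewrite /Num.min /Num.max.
    have [->|g0] := eqVneq g 0; first by constructor 1.
    have [->|w0] := eqVneq (w 0 i) 0; first by constructor 2.
    (* Both absolute values are positive, so a zero gap forces the maximum to be 0, which is the
       pair of sign conditions. *)
    rewrite -normr_gt0 in g0; rewrite -normr_gt0 in w0.
    move=> h; constructor 3; move: h.
    by (do !case: ifPn) => *; split; lra.
exists (c / n.+1%:R); first exact: divr_gt0.
move=> w /cw[i cwi]; exists i; apply: le_lt_trans cwi.
by rewrite mulrAC ler_pdivrMr // -mulrA ler_pM2l // mulrC enorm_le_norm.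
Qed.

End Complementarity.

(** * First-order descent of the Euclidean norm, and compactness of the complementary pairs near a
    point *)

Section Sufficiency.
Local Open Scope classical_set_scope.
Variable R : realType.

(** Concavity of the square root, obtained from [(|y + h| - |y|)^2 >= 0]. *)
Lemma enorm_add_le n (y h : 'rV[R]_n) : y != 0 ->
  enorm (y + h) <= enorm y + (dot y h + dot h h / 2) / enorm y.
Proof.
move=> y0; have y_gt0 : 0 < enorm y.
  rewrite lt_neqAle enorm_ge0 andbT eq_sym.
  by apply: contra_neq y0 => /enorm_eq0.
rewrite -subr_ge0 -(pmulr_rge0 _ y_gt0) mulrBr mulrDr mulrCA divff ?gt_eqF //.
have : enorm (y + h) ^+ 2 = enorm y ^+ 2 + dot y h *+ 2 + dot h h.
  by rewrite !sqr_enorm dotDl !dotDr (dotC h y); ring.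
have := sqr_ge0 (enorm (y + h) - enorm y); nra.
Qed.

(** A first-order decrease at rate [g] leaves a true decrease at a smaller rate [e] when the step
    [t] is small against the second-order constant [H]. *)
Lemma enorm_descent n (y h : 'rV[R]_n) (t g H e : R) : y != 0 -> 0 < t ->
  dot y h <= - (t * g * enorm y) -> dot h h <= H * t ^+ 2 ->
  t * H < 2 * (g - e) * enorm y -> enorm (y + h) < enorm y - e * t.
Proof.
move=> y0 t0 yh hh tH; have y_gt0 : 0 < enorm y.
  rewrite lt_neqAle enorm_ge0 andbT eq_sym.
  by apply: contra_neq y0 => /enorm_eq0.
apply: le_lt_trans (enorm_add_le _ y0) _.
rewrite ltrD2l ltr_pdivrMr //.
have : t * (t * H) < t * (2 * (g - e) * enorm y) by rewrite ltr_pM2l.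
nra.
Qed.

(** Here [s] is a variable of its own and not the value [f p a], so the set does not depend on the
    parameter; the equation [s = f p a] is left to the residual. *)
Definition comp_pairs n : set ('rV[R]_n * 'rV[R]_n) :=
  [set z : 'rV[R]_n * 'rV[R]_n | forall i, [/\ 0 <= z.1 0 i, 0 <= z.2 0 i & z.1 0 i * z.2 0 i = 0]].

Lemma comp_pairs_closed n : closed (@comp_pairs n).
Proof.
pose V := ('rV[R]_n * 'rV[R]_n)%type.
have c1 i : continuous (fun z : V => z.1 0 i).
  move=> z; exact: (continuous_comp (@cvg_fst _ _ _ _ _) (@entry_continuous R n i z.1)).
have c2 i : continuous (fun z : V => z.2 0 i).
  move=> z; exact: (continuous_comp (@cvg_snd _ _ _ _ _) (@entry_continuous R n i z.2)).
rewrite (_ : @comp_pairs n = \bigcap_(i : 'I_n) ([set z : V | 0 <= z.1 0 i] `&`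
    [set z : V | 0 <= z.2 0 i] `&`
    [set z : V | z.1 0 i * z.2 0 i = 0])).
  apply: closed_bigI => i _; apply: closedI; first apply: closedI.
  - apply: (@closed_comp _ _ (fun z : V => z.1 0 i) [set x | 0 <= x]).
      by move=> z _; exact: c1.
    exact: closed_ge.
  - apply: (@closed_comp _ _ (fun z : V => z.2 0 i) [set x | 0 <= x]).
      by move=> z _; exact: c2.
    exact: closed_ge.
  - apply: (@closed_comp _ _ (fun z : V => z.1 0 i * z.2 0 i) [set x | x = 0]).
      by move=> z _; apply: cvgM; [exact: c1|exact: c2].
    exact: closed_eq.
apply/seteqP; split=> z /= hz i; first by move=> _; have [] := hz i.
by have [[]] := hz i I.
Qed.

Lemma comp_pairs_box_compact n (z0 : 'rV[R]_n * 'rV[R]_n) r :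
  compact (@comp_pairs n `&` [set z | `|z - z0| <= r]).
Proof.
have c12 := compact_setX (@norm_ball_compact R n z0.1 r)
  (@norm_ball_compact R n z0.2 r).
rewrite setIC (_ : [set z | _] =
    [set x | `|x - z0.1| <= r] `*` [set x | `|x - z0.2| <= r]).
  exact: (compact_closedI c12 (@comp_pairs_closed n)).
by apply/seteqP; split=> z /=; rewrite prod_normE ge_max => /andP.
Qed.

End Sufficiency.

(** * Decreasing the residual by moving one coordinate *)

Section Descent.
Local Open Scope classical_set_scope.
Variable R : realType.

Lemma dot_delta n i (x : 'rV[R]_n) : dot (delta_mx 0 i) x = x 0 i.
Proof. by rewrite dotE -rowE !mxE. Qed.

Lemma norm_scale_delta n (i : 'I_n) (k : R) : `|k *: delta_mx 0 i : 'rV[R]_n| <= `|k|.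
Proof.
rewrite normrZ ler_piMr // norm_le_entries // => j l.
by rewrite !mxE; case: andP => _; rewrite ?normr1 ?normr0.
Qed.

(* The index [i] with a large gap for [- y] tells which coordinate to move:
   [a_i] or [s_i], in either direction if it is positive, and upwards if both
   vanish. *)
Lemma comp_pairs_descent n (phi : 'rV[R]_n -> 'rV[R]_n) (a0 s0 : 'rV[R]_n) M
    (c d r : R) (a s : 'rV[R]_n) :
  (forall a1 a2, `|a1 - a0| <= r -> `|a2 - a0| <= r ->
     `|phi a1 - phi a2 - (a1 - a2) *m M| <= d * `|a1 - a2|) ->
  (forall i, 0 < a0 0 i -> r < a0 0 i) -> (forall i, 0 < s0 0 i -> r < s0 0 i) ->
  (forall w, w != 0 -> exists i, c * enorm w < multiplier_gap a0 s0 M i w) ->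
  0 < c -> 0 <= d -> 4 * n%:R * d <= c ->
  comp_pairs (a, s) -> `|a - a0| < r -> `|s - s0| < r -> phi a != s ->
  exists z, [/\ comp_pairs z, `|z.1 - a0| <= r, `|z.2 - s0| <= r &
    enorm (phi z.1 - z.2) < enorm (phi a - s) - c / 2 * `|z - (a, s)|].
Proof.
move=> phiM a0r s0r gap c0 d0 dc as_comp ar sr phias.
pose y := phi a - s; pose g := - y *m M^T.
have y0 : y != 0 by rewrite subr_eq0.
have Y0 : 0 < enorm y.
  by rewrite lt_neqAle enorm_ge0 andbT eq_sym; apply: contra_neq y0 => /enorm_eq0.
(* The first term bounds the squared change of the residual when [a] moves, the summand 1 the one
   when [s] moves. *)
pose H : R := n%:R * (n%:R * `|M| + d) ^+ 2 + 1.
have H0 : 0 < H by rewrite ltr_wpDl // mulr_ge0 // sqr_ge0.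
(* The first two bounds keep the moved pair in the box; the third makes the second-order term
   harmless. *)
pose t0 := Num.min (Num.min (r - `|a - a0|) (r - `|s - s0|)) (c * enorm y / (4 * H)).
have t00 : 0 < t0 by rewrite !lt_min !subr_gt0 ar sr divr_gt0 ?mulr_gt0.
have t0P t : t <= t0 -> [/\ t <= r - `|a - a0|, t <= r - `|s - s0| &
    t * (4 * H) <= c * enorm y].
  by rewrite !le_min ler_pdivlMr ?mulr_gt0 // => /andP[/andP[]].
(* [k] is the direction of the move, and [rho] is a step length up to which [a_i] stays
   nonnegative. *)
have move_a i (k rho : R) : `|k| = 1 -> c * enorm y <= k * g 0 i -> s 0 i = 0 ->
    0 < rho -> (forall t, 0 < t -> t <= rho -> 0 <= a 0 i + k * t) ->
  exists z, [/\ comp_pairs z, `|z.1 - a0| <= r, `|z.2 - s0| <= r &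
    enorm (phi z.1 - z.2) < enorm y - c / 2 * `|z - (a, s)|].
  move=> k1 kg si0 rho0 kt.
  pose t := Num.min t0 rho.
  have t_gt0 : 0 < t by rewrite lt_min t00.
  have [tt0 trho] : t <= t0 /\ t <= rho by split; rewrite ge_min lexx ?orbT.
  have [t1 t2 t3] := t0P _ tt0.
  pose v : 'rV[R]_n := (k * t) *: delta_mx 0 i.
  have vt : `|v| <= t.
    by rewrite (le_trans (norm_scale_delta _ _)) // normrM k1 mul1r gtr0_norm.
  have avr : `|a + v - a0| <= r.
    by rewrite addrAC (le_trans (ler_normD _ _)) //; lra.
  exists (a + v, s); split => //=; last 2 first.
  - exact: ltW.
  - rewrite prod_normE /= subrr normr0 addrAC subrr add0r max_l //.
    have := phiM _ _ avr (ltW ar); rewrite [a + v - a]addrAC subrr add0r.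
    set e := phi (a + v) - phi a - v *m M => he.
    have -> : phi (a + v) - s = y + (v *m M + e).
      by rewrite /e /y (addrC (v *m M)) subrK [RHS]addrC subrKA.
    have {}he : `|e| <= d * t by rewrite (le_trans he) // ler_wpM2l.
    have hH : dot (v *m M + e) (v *m M + e) <= H * t ^+ 2.
      apply: le_trans (ler_norm _) _; apply: le_trans (dot_le_norm _ _) _.
      have le_h : `|v *m M + e| <= (n%:R * `|M| + d) * t.
        rewrite (le_trans (ler_normD _ _)) // mulrDl lerD //.
        by rewrite (le_trans (mulmx_norm_le _ _)) // ler_wpM2l // mulr_ge0.
      have : n%:R * (`|v *m M + e| * `|v *m M + e|)
          <= n%:R * (((n%:R * `|M| + d) * t) * ((n%:R * `|M| + d) * t)).
        by rewrite ler_wpM2l // ler_pM.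
      have := sqr_ge0 t; rewrite /H; nra.
    (* The gap gives the rate [c]; the linearization error takes away at most [c / 4], and [c / 2]
       is the rate required. *)
    apply: lt_le_trans (enorm_descent (t := t) (g := 3 / 4 * c) (H := H)
      (e := c / 2) y0 t_gt0 _ hH _) _; last first.
    + by rewrite lerD2l lerN2 ler_wpM2l // ltW // divr_gt0.
    + nra.
    rewrite dotDr; have : dot y (v *m M) = - t * (k * g 0 i).
      rewrite dotC dot_mulmx dotZl dot_delta /g mulNmx [X in _ * (_ * X)]mxE; ring.
    have : dot y e <= c / 4 * t * enorm y.
      apply: le_trans (ler_norm _) _; apply: le_trans (dot_le_norm _ _) _.
      have : n%:R * (`|y| * `|e|) <= n%:R * (enorm y * (d * t)).
        by rewrite ler_wpM2l // ler_pM // norm_le_enorm.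
      have : (4 * n%:R * d) * (t * enorm y) <= c * (t * enorm y).
        by rewrite ler_wpM2r // mulr_ge0 // ltW.
      lra.
    have : t * (c * enorm y) <= t * (k * g 0 i) by rewrite ler_pM2l.
    move=> h1 h2 ->; lra.
  - move=> j; rewrite !mxE eqxx /=; have [aj sj asj] := as_comp j.
    have [->|ji] := eqVneq j i; last by rewrite mulr0 addr0.
    by rewrite si0 mulr1 mulr0; split => //; exact: kt.

(* Moving [s_i] leaves [phi a] unchanged, so there is no linearization error. *)
have move_s i (k rho : R) : `|k| = 1 -> c * enorm y <= - k * - y 0 i ->
    a 0 i = 0 ->
    0 < rho -> (forall t, 0 < t -> t <= rho -> 0 <= s 0 i + k * t) ->
  exists z, [/\ comp_pairs z, `|z.1 - a0| <= r, `|z.2 - s0| <= r &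
    enorm (phi z.1 - z.2) < enorm y - c / 2 * `|z - (a, s)|].
  move=> k1 kg ai0 rho0 kt.
  pose t := Num.min t0 rho.
  have t_gt0 : 0 < t by rewrite lt_min t00.
  have [tt0 trho] : t <= t0 /\ t <= rho by split; rewrite ge_min lexx ?orbT.
  have [t1 t2 t3] := t0P _ tt0.
  pose v : 'rV[R]_n := (k * t) *: delta_mx 0 i.
  have vt : `|v| <= t.
    by rewrite (le_trans (norm_scale_delta _ _)) // normrM k1 mul1r gtr0_norm.
  exists (a, s + v); split => //=; last 2 first.
  - by rewrite addrAC (le_trans (ler_normD _ _)) //; lra.
  - rewrite prod_normE /= subrr normr0 addrAC subrr add0r max_r //.
    rewrite opprD addrA -/y.
    have k2 : k * k = 1 by rewrite -expr2 -(real_normK (num_real k)) k1 expr1n.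
    have vv : dot v v = t ^+ 2.
      by rewrite dotZl dotC dotZl dot_delta mxE !eqxx mulr1 mulrACA k2 mul1r.
    have hH : dot (- v) (- v) <= H * t ^+ 2.
      rewrite dotNl dotNr opprK vv ler_peMl ?sqr_ge0 // /H lerDr.
      by rewrite mulr_ge0 // sqr_ge0.
    apply: lt_le_trans (enorm_descent (t := t) (g := 3 / 4 * c) (H := H)
      (e := c / 2) y0 t_gt0 _ hH _) _; last first.
    + by rewrite lerD2l lerN2 ler_wpM2l // ltW // divr_gt0.
    + nra.
    rewrite dotNr dotC dotZl dot_delta.
    have : t * (c * enorm y) <= t * (- k * - y 0 i) by rewrite ler_pM2l.
    have := mulr_gt0 t_gt0 (mulr_gt0 c0 Y0).
    lra.
  - move=> j; rewrite !mxE eqxx /=; have [aj sj asj] := as_comp j.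
    have [->|ji] := eqVneq j i; last by rewrite mulr0 addr0.
    by rewrite ai0 mulr1 mul0r; split => //; exact: kt.
  - exact: ltW.
have ny0 : - y != 0 by rewrite oppr_eq0.
case: (gap _ ny0) => i.
rewrite [enorm (- y)](_ : _ = enorm y); last first.
  by rewrite /enorm dotNl dotNr opprK.
have [ai si asi] := as_comp i; rewrite /= in ai si asi.
have ad : `|a 0 i - a0 0 i| <= `|a - a0|.
  by have := entry_le_norm (a - a0) 0 i; rewrite !mxE.
have sd : `|s 0 i - s0 0 i| <= `|s - s0|.
  by have := entry_le_norm (s - s0) 0 i; rewrite !mxE.
have a0_gt0 : 0 < a0 0 i -> 0 < a 0 i.
  by move/a0r; move: ad; rewrite ler_norml => /andP[]; lra.
have s0_gt0 : 0 < s0 0 i -> 0 < s 0 i.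
  by move/s0r; move: sd; rewrite ler_norml => /andP[]; lra.
have sgP (x : R) : exists k : R, `|k| = 1 /\ k * x = `|x|.
  case: (leP 0 x) => x0; first by exists 1; rewrite normr1 mul1r ger0_norm.
  by exists (-1); rewrite normrN1 mulN1r ltr0_norm.
have cY := mulr_gt0 c0 Y0.
rewrite /multiplier_gap -/g.
have -> : (- y) 0 i = - y 0 i by rewrite mxE.
(* A positive coordinate may move in either direction, so the sign of the gap entry can be matched;
   a positive [a_i] also excludes that [s0_i] is positive, and vice versa. *)
have [a_gt0|a_le0] := ltP 0 (a 0 i).
  have si0 : s 0 i = 0.
    by move/eqP: asi; rewrite mulf_eq0 (gt_eqF a_gt0) => /eqP.
  have /negPf -> : ~~ (0 < s0 0 i) by apply/negP => /s0_gt0; rewrite si0 ltxx.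
  move=> gap_i; have [k [k1 kg]] := sgP (g 0 i).
  apply: (move_a i k (a 0 i)) => //.
    rewrite kg ltW //; apply: lt_le_trans gap_i _.
    by case: ifP => // _; rewrite !ge_min lexx.
  move=> t t_gt0 ta; have : `|k * t| <= t by rewrite normrM k1 mul1r gtr0_norm.
  by rewrite ler_norml => /andP[]; lra.
have ai0 : a 0 i = 0 by apply/eqP; rewrite eq_le a_le0.
have /negPf -> : ~~ (0 < a0 0 i) by apply/negP => /a0_gt0; rewrite ai0 ltxx.
have [s_gt0|s_le0] := ltP 0 (s 0 i).
  move=> gap_i; have [k [k1 kg]] := sgP (y 0 i).
  apply: (move_s i k (s 0 i)) => //.
    rewrite mulrNN kg ltW //; apply: lt_le_trans gap_i _.
    by case: ifP => _; rewrite ?normrN // !ge_min lexx ?orbT.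
  move=> t t_gt0 ta; have : `|k * t| <= t by rewrite normrM k1 mul1r gtr0_norm.
  by rewrite ler_norml => /andP[]; lra.
have si0 : s 0 i = 0 by apply/eqP; rewrite eq_le s_le0.
have /negPf -> : ~~ (0 < s0 0 i) by apply/negP => /s0_gt0; rewrite si0 ltxx.
(* With [a_i = s_i = 0] only upward moves are admissible; the maximum in the gap says that one of
   them decreases the residual. *)
rewrite lt_min => /andP[_]; rewrite !lt_max orbC ltNge (ltW cY) /= opprK.
case/orP => h.
  apply: (move_a i 1 1) => //; rewrite ?normr1 ?mul1r ?ltW // => t t_gt0 _.
  by rewrite ai0 add0r mul1r ltW.
apply: (move_s i 1 1) => //; rewrite ?normr1 ?mulN1r ?opprK ?ltW // => t t_gt0 _.
by rewrite si0 add0r mul1r ltW.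
Qed.
End Descent.

(** * Lipschitz behaviour of the solutions versus absence of multipliers *)

Section Equivalence.
Local Open Scope classical_set_scope.
Variable R : realType.

Lemma enorm_continuous n : continuous (@enorm R n).
Proof.
have -> : @enorm R n = Num.sqrt \o (fun x => dot x x) by [].
have cdot : continuous (fun x : 'rV[R]_n => dot x x).
  apply: (@sum_continuous _ _ _ _ (fun i (x : 'rV[R]_n) => x 0 i * x 0 i)) => i.
  have ci := @entry_continuous R n i.
  by move=> x; exact: (cvgM (ci x) (ci x)).
by move=> x; exact: (continuous_comp (cdot x) (@sqrt_continuous R _)).
Qed.

Lemma sub_fst_snd_continuous (V W : normedModType R) (g : V -> W) :
  continuous g -> continuous (fun z : V * W => g z.1 - z.2).
Proof.
move=> cg z; apply: cvgB; last exact: cvg_snd.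
exact: (continuous_comp (@cvg_fst _ _ _ _ _) (cg z.1)).
Qed.

Lemma ncp_lip_like m n (f : 'rV[R]_m -> 'rV[R]_n -> 'rV[R]_n) p0 a0 P M :
  strict_diff2 f p0 a0 P M -> (forall p, continuous (f p)) ->
  ncp f p0 a0 -> no_multiplier a0 (f p0 a0) M -> lip_like (ncp f) p0 a0.
Proof.
move=> sf cf sol nm; pose s0 := f p0 a0.
have [c c0 gap] : exists2 c : R, 0 < c &
    forall w, w != 0 -> exists i, c * enorm w < multiplier_gap a0 s0 M i w.
  by apply: no_multiplier_gap nm => i; have [] := sol i.
pose d : R := c / (4 * n.+1%:R).
have n1 : 0 < n.+1%:R :> R by [].
have d0 : 0 < d by rewrite divr_gt0 // mulr_gt0.
have dc : 4 * n%:R * d <= c.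
  rewrite /d mulrCA ger_pMr // ler_pdivrMr ?mulr_gt0 // mul1r.
  by rewrite ler_pM2l // ler_nat.
have [r1 r10 fr] := sf d d0.
have [L [r2 [L0 r20 fL]]] := strict_diff2_lipschitz sf.
have [r3 r30 ar3] := lower_bound_of_positive (a0 0).
have [r4 r40 sr4] := lower_bound_of_positive (s0 0).
(* Halving makes all four bounds strict, so the positive entries of [a0] and [s0] exceed [r]. *)
pose r := Num.min (Num.min r1 r2) (Num.min r3 r4) / 2.
have r_gt0 : 0 < r by rewrite divr_gt0 // !lt_min r10 r20 r30.
have [rr1 rr2 rr3 rr4] : [/\ r < r1, r < r2, r < r3 & r < r4].
  have : r < Num.min (Num.min r1 r2) (Num.min r3 r4).
    by rewrite /r ltr_pdivrMr // mulr_natr mulr2n ltrDr !lt_min r10 r20 r30.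
  by rewrite !lt_min => /andP[/andP[-> ->] /andP[-> ->]].
pose e := c / 2; have e0 : 0 < e by rewrite divr_gt0.
(* The first two bounds place [(a1, s1)] within [r / 2] of [(a0, s0)]; the third makes its residual
   for [p2] at most [e * r / 4]. *)
pose rho := Num.min (r / 2) (Num.min (r / (4 * L)) (e * r / (8 * (n.+1%:R * L)))).
have nL : 0 < n.+1%:R * L by rewrite mulr_gt0.
have rho0 : 0 < rho by rewrite !lt_min; apply/and3P; split; apply: divr_gt0; rewrite // mulr_gt0.
have [rhor rhoL rhoe] : [/\ rho <= r / 2, rho * (4 * L) <= r &
    rho * (8 * (n.+1%:R * L)) <= e * r].
  have : rho <= rho by []. 
  by rewrite {2}/rho !le_min !ler_pdivlMr ?mulr_gt0 // => /andP[-> /andP[-> ->]].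
exists (n.+1%:R * L / e), rho; split; [exact: divr_gt0|by []|].
move=> p1 p2 a1 p1r p2r a1_sol a1r.
pose s1 := f p1 a1.
have s1r : `|s1 - s0| <= r / 2.
  have : `|s1 - s0| <= L * (`|p1 - p0| + `|a1 - a0|).
    by apply: fL; rewrite ?subrr ?normr0; lra.
  have : L * (`|p1 - p0| + `|a1 - a0|) <= L * (rho + rho).
    by rewrite ler_pM2l // lerD.
  lra.
have phi1 : enorm (f p2 a1 - s1) <= n.+1%:R * L * `|p1 - p2|.
  apply: le_trans (enorm_le_norm _) _; rewrite -mulrA ler_pM2l //.
  have : `|f p2 a1 - f p1 a1| <= L * (`|p2 - p1| + `|a1 - a1|)
    by apply: fL; lra.
  by rewrite subrr normr0 addr0 (distrC p1).
have phi1r : enorm (f p2 a1 - s1) <= e * (r / 4).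
  have : n.+1%:R * L * `|p1 - p2| <= n.+1%:R * L * (rho + rho).
    rewrite ler_pM2l // -(subrKA p0) (le_trans (ler_normD _ _)) //.
    by rewrite lerD // distrC.
  lra.
pose z1 := (a1, s1).
have [|||||z [[zcomp zbox] phiz ez]] := @zero_of_descent R _
    (@comp_pairs R n `&` [set z | `|z - (a0, s0)| <= r])
    (fun z => enorm (f p2 z.1 - z.2)) z1 e.
- exact: comp_pairs_box_compact.
- move=> z; have cz := sub_fst_snd_continuous (cf p2) (x := z).
  exact: (continuous_comp cz (@enorm_continuous n _)).
- split; first exact: a1_sol.
  rewrite /= prod_normE ge_max /=; apply/andP; split; lra.
- exact: ltW.
- case=> a s [zcomp /=]; rewrite prod_normE ge_max /= => /andP[ar sr] phiz ez.
  (* The penalty confines the candidate to distance [r / 4] from [z1], hence strictly inside the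
     box, where coordinate moves are available. *)
  have {}ez : e * `|(a, s) - z1| <= e * (r / 4).
    apply: le_trans ez _; have := enorm_ge0 (f p2 a - s); lra.
  rewrite ler_pM2l // prod_normE ge_max /= in ez.
  case/andP: ez => aa1 ss1.
  have ar' : `|a - a0| < r.
    rewrite -(subrKA a1) (le_lt_trans (ler_normD _ _)) //; lra.
  have sr' : `|s - s0| < r.
    rewrite -(subrKA s1) (le_lt_trans (ler_normD _ _)) //; lra.
  have [||||z' [z'comp z'a z's z'd]] := @comp_pairs_descent R n (f p2) a0 s0
      M c d r a s _ _ _ gap c0 (ltW d0) dc zcomp ar' sr'.
  + move=> a2 a3 a2r a3r.
    have := fr p2 p2 a2 a3; rewrite subrr normr0 mul0mx !add0r.
    have p2r1 : `|p2 - p0| <= r1 by lra.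
    by apply=> //; exact: le_trans (ltW rr1).
  + by move=> i /ar3; exact: lt_le_trans.
  + by move=> i /sr4; exact: lt_le_trans.
  + by apply: contra_neq phiz => ->; rewrite subrr /enorm dot0l sqrtr0.
  exists z' => //; split => //=; rewrite prod_normE ge_max /=.
  by apply/andP.
exists z.1.
  move=> i; have [zi1 zi2 zi] := zcomp i.
  suff -> : f p2 z.1 = z.2 by [].
  by apply/eqP; rewrite -subr_eq0; apply/eqP/enorm_eq0.
rewrite mulrAC ler_pdivlMr // mulrC (le_trans _ phi1) // (le_trans _ ez) //.
rewrite ler_pM2l // distrC.
by rewrite [leRHS]prod_normE le_max lexx.
Qed.

Lemma entry_gt0_near n (x y : 'rV[R]_n) c i :
  `|x - y| < c -> c <= x 0 i -> 0 < y 0 i.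
Proof.
move=> xy; have := le_lt_trans (entry_le_norm _ 0 i) xy.
by rewrite [(x - y) 0 i]mxE [X in _ + X]mxE ltr_norml => /andP[_]; lra.
Qed.

(** Raise [a_i] by [t] where [s0_i = g_i = 0], and among the other indices raise [s_i] where
    [w_i = 0]. At the indices that remain both coordinates vanish and the sign conditions hold. The
    margin [t] survives perturbations smaller than [t]. *)
Lemma complementary_shift n (a0 s0 g w : 'rV[R]_n) t : 0 < t ->
  (forall i, [/\ 0 <= a0 0 i, 0 <= s0 0 i & a0 0 i * s0 0 i = 0]) ->
  (forall i, 0 < a0 0 i -> g 0 i = 0) -> (forall i, 0 < s0 0 i -> w 0 i = 0) ->
  (forall i, ~~ (0 < a0 0 i) -> ~~ (0 < s0 0 i) ->
     [\/ g 0 i = 0, w 0 i = 0 | g 0 i <= 0 /\ 0 <= w 0 i]) ->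
  exists a1 s1 : 'rV[R]_n, [/\ `|a1 - a0| <= t, `|s1 - s0| <= t & forall i,
    [\/ [/\ t <= a1 0 i, s1 0 i = 0 & g 0 i = 0],
        [/\ a1 0 i = 0, t <= s1 0 i & w 0 i = 0] |
        [/\ a1 0 i = 0, s1 0 i = 0, g 0 i <= 0 & 0 <= w 0 i]]].
Proof.
move=> t0 sol gw_a w_s gw.
pose Pl i := ~~ (0 < s0 0 i) && (g 0 i == 0).
pose Mi i := ~~ Pl i && (w 0 i == 0).
pose a1 : 'rV[R]_n := \row_i (a0 0 i + t * (Pl i)%:R).
pose s1 : 'rV[R]_n := \row_i (s0 0 i + t * (Mi i)%:R).
have shift_le (x : 'rV[R]_n) (B : pred 'I_n) :
    `|\row_i (x 0 i + t * (B i)%:R) - x| <= t.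
  apply: norm_le_entries => [|i j]; first exact: ltW.
  rewrite !mxE ord1 addrAC subrr add0r; case: (B j).
    by rewrite mulr1 gtr0_norm.
  by rewrite mulr0 normr0 ltW.
exists a1, s1; split=> [||i]; try exact: shift_le.
have [ai si asi] := sol i.
have -> : a1 0 i = a0 0 i + t * (Pl i)%:R by rewrite mxE.
have -> : s1 0 i = s0 0 i + t * (Mi i)%:R by rewrite mxE.
rewrite /Mi; have [PlI|nPl] := boolP (Pl i).
  case/andP: (PlI); rewrite -leNgt => si0 /eqP gi.
  constructor 1; rewrite /= mulr0 mulr1 addr0.
  by split; [rewrite lerDr|apply/eqP; rewrite eq_le si0|].
have ai0 : ~~ (0 < a0 0 i).
  apply/negP => ai0; move/negP: nPl; apply; rewrite /Pl (gw_a _ ai0) eqxx andbT.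
  by rewrite lt_neqAle eq_sym si andbT negbK; move/eqP: asi; rewrite mulf_eq0 gt_eqF.
have a00 : a0 0 i = 0 by apply/eqP; rewrite eq_le ai leNgt ai0.
rewrite a00 mulr0 addr0 /=; have [wi|wi] := eqVneq (w 0 i) 0.
  by constructor 2; rewrite mulr1 lerDr.
have si0 : ~~ (0 < s0 0 i) by apply/negP => /w_s /eqP; apply/negP.
constructor 3; rewrite mulr0 addr0.
case: (gw i ai0 si0) => [gi|wi0|[]]; last by split => //; apply/eqP; rewrite eq_le si leNgt si0.
  by move: nPl; rewrite /Pl si0 gi eqxx.
by rewrite wi0 eqxx in wi.
Qed.

Lemma lip_like_no_multiplier m n (f : 'rV[R]_m -> 'rV[R]_n -> 'rV[R]_n)
    p0 a0 P M (A : 'M[R]_(n, m)) :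
  strict_diff2 f p0 a0 P M -> A *m P = 1%:M -> (forall x, continuous (f ^~ x)) ->
  ncp f p0 a0 -> lip_like (ncp f) p0 a0 -> no_multiplier a0 (f p0 a0) M.
Proof.
move=> sf AP cf sol [k [r [k0 r_gt0 lip]]] w gw_a w_s gw.
set s0 := f p0 a0 in w_s gw; set g := w *m M^T in gw_a gw.
apply/eqP/negPn/negP => w0.
have D0 : 0 < dot w w.
  by rewrite lt_neqAle dot_ge0 andbT eq_sym; apply: contra_neq w0 => /dot_eq0.
pose q := - w *m A; have qP : q *m P = - w by rewrite -mulmxA AP mulmx1.
(* For a step [h], parameter and solution together move by at most [(1 + k) * h * |q|], so the
   linearization error paired with [w] is at most [h * E * d]; [d] makes this less than
   [h * <w, w>]. *)
pose E := n%:R * `|w| * ((1 + k) * `|q|).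
have E0 : 0 <= E by rewrite !mulr_ge0 // addr_ge0 // ltW.
pose d := dot w w / (E + 1).
have E1 : 0 < E + 1 by rewrite ltr_wpDl.
have d0 : 0 < d by rewrite divr_gt0.
have dE : E * d < dot w w.
  by rewrite mulrCA gtr_pMr // ltr_pdivrMr // mul1r ltrDl.
have [r1 r10 fr] := sf d d0.
have [L [r2 [L0 r20 fL]]] := strict_diff2_lipschitz sf.
have [C [r3 [C0 r30 fC]]] := strict_diff2_open sf AP cf.
pose r0 := Num.min r (Num.min r1 r2).
have r00 : 0 < r0 by rewrite !lt_min r_gt0 r10.
have [r0r r01 r02] : [/\ r0 <= r, r0 <= r1 & r0 <= r2].
  by have := lexx r0; rewrite {2}/r0 !le_min => /and3P[].
pose t := Num.min r3 (Num.min (r0 / 2) (r0 / (4 * C))).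
have t0 : 0 < t.
  by rewrite !lt_min; apply/and3P; split; rewrite // divr_gt0 // mulr_gt0.
have [tr3 tr0 tC] : [/\ t <= r3, t <= r0 / 2 & t * (4 * C) <= r0].
  rewrite -(ler_pdivlMr (z := 4 * C)) ?mulr_gt0 //.
  by have := lexx t; rewrite {2}/t !le_min => /and3P[].
have [|a1 [s1 [a1t s1r comp]]] := complementary_shift t0 _ gw_a w_s gw.
  by move=> i; exact: sol.
have [p1 fp1 p1r] : exists2 p1, f p1 a1 = s1 & `|p1 - p0| <= r0 / 2.
  have [||p1 fp1 p1r] := fC a1 s1; [exact: le_trans a1t _|exact: le_trans s1r _|].
  exists p1 => //; apply: le_trans p1r _.
  have : C * (`|a1 - a0| + `|s1 - s0|) <= C * (t + t) by rewrite ler_pM2l // lerD.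
  lra.
have a1sol : ncp f p1 a1.
  move=> i; rewrite fp1.
  by case: (comp i) => [[h1 -> _]|[-> h2 _]|[-> -> _ _]];
    rewrite ?mulr0 ?mul0r; split => //; exact: le_trans (ltW t0) _.
(* [B] bounds the movement of solution and image per unit step, so [h = t / (2 * B)] keeps both
   below the margin [t]. *)
pose B := (1 + k) * `|q| * (1 + L) + 1.
have kq : 0 <= (1 + k) * `|q| by rewrite mulr_ge0 // addr_ge0 // ltW.
have B0 : 0 < B by rewrite ltr_wpDl // mulr_ge0 // addr_ge0 // ltW.
pose h := t / (2 * B); have h0 : 0 < h by rewrite divr_gt0 // mulr_gt0.
have hB : h * (2 * B) = t by rewrite mulfVK // gt_eqF // mulr_gt0.
pose p2 := p1 + h *: q.
have p12 : `|p1 - p2| = h * `|q|.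
  by rewrite opprD addrA subrr add0r normrN normrZ gtr0_norm.
have hq0 : 0 <= h * `|q| by rewrite mulr_ge0 // ltW.
have hkq0 : 0 <= k * (h * `|q|) by rewrite mulr_ge0 // ltW.
have hL : (1 + L) * ((1 + k) * (h * `|q|)) <= t / 2.
  have : (1 + L) * ((1 + k) * (h * `|q|)) = h * (B - 1) by rewrite /B; ring.
  by move: hB h0; nra.
have hLkq : 0 <= L * ((1 + k) * (h * `|q|)).
  by rewrite mulr_ge0 ?(ltW L0) // mulr_ge0 // addr_ge0 // ltW.
have hkq_lt : (1 + k) * (h * `|q|) <= t / 2.
  by move: hL; rewrite mulrDl mul1r; apply: le_trans; rewrite lerDl.
have t_half : t / 2 < t by rewrite ltr_pdivrMr // ltr_pMr // ltr1n.
have hq_lt : h * `|q| <= t / 2.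
  by apply: le_trans hkq_lt; rewrite mulrDl mul1r lerDl.
have hk_lt : k * (h * `|q|) < t.
  by apply: le_lt_trans t_half; apply: le_trans hkq_lt; rewrite mulrDl mul1r lerDr.
have p2r : `|p2 - p0| <= r0.
  rewrite -(subrKA p1) (le_trans (ler_normD _ _)) // distrC p12.
  by apply: le_trans (lerD hq_lt p1r) _; rewrite [leRHS]splitr lerD2r ltW // (lt_le_trans t_half).
have r0_half : r0 / 2 <= r0 by rewrite ler_pdivrMr // ler_peMr ?ler1n // ltW.
have p1r0 := le_trans p1r r0_half.
have a1r := le_trans a1t tr0.
have a1r0 := le_trans a1r r0_half.
have [a2 a2sol a12] := lip p1 p2 a1 (le_trans p1r0 r0r) (le_trans p2r r0r) a1sol
  (le_trans a1r0 r0r).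
rewrite p12 in a12.
have a2r : `|a2 - a0| <= r0.
  rewrite -(subrKA a1) (le_trans (ler_normD _ _)) // distrC.
  apply: le_trans (lerD (le_trans a12 (ltW hk_lt)) a1r) _.
  by rewrite [leRHS]splitr lerD2r.
have [p1r1 p2r1] := (le_trans p1r0 r01, le_trans p2r r01).
have [a1r1 a2r1] := (le_trans a1r0 r01, le_trans a2r r01).
have [p1r2 p2r2] := (le_trans p1r0 r02, le_trans p2r r02).
have [a1r2 a2r2] := (le_trans a1r0 r02, le_trans a2r r02).
pose b := f p2 a2.
have bs1 : `|b - s1| <= t / 2.
  rewrite -fp1; apply: le_trans (_ : L * (`|p2 - p1| + `|a2 - a1|) <= _).
    exact: fL.
  rewrite (distrC p2) p12 (distrC a2).
  have : L * (h * `|q| + `|a1 - a2|) <= L * (h * `|q| + k * (h * `|q|)).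
    by rewrite ler_pM2l // lerD2l.
  move/le_trans; apply; apply: le_trans hL.
  rewrite (_ : _ + k * _ = (1 + k) * (h * `|q|)); last by rewrite mulrDl mul1r.
  by rewrite [leRHS]mulrDl mul1r lerDr mulr_ge0 // addr_ge0 // ltW.
pose e := b - s1 - ((p2 - p1) *m P + (a2 - a1) *m M).
have eE : `|dot w e| <= h * (E * d).
  apply: le_trans (dot_le_norm _ _) _.
  have : `|e| <= d * (`|p2 - p1| + `|a2 - a1|) by rewrite /e -fp1; exact: fr.
  rewrite (distrC p2) p12 (distrC a2) => he.
  have {}he : `|e| <= d * ((1 + k) * (h * `|q|)).
    by apply: le_trans he _; rewrite ler_pM2l // mulrDl mul1r lerD2l.
  have : n%:R * (`|w| * `|e|) <= n%:R * (`|w| * (d * ((1 + k) * (h * `|q|)))).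
    by rewrite !ler_wpM2l.
  by move/le_trans; apply; rewrite le_eqVlt; apply/orP; left; apply/eqP; rewrite /E; ring.
have wb : dot w (b - s1) = - h * dot w w + dot (a2 - a1) g + dot w e.
  have -> : b - s1 = h *: (- w) + (a2 - a1) *m M + e.
    rewrite /e [p2 - p1]addrAC subrr add0r -scalemxAl qP.
    by rewrite [RHS]addrC subrK.
  rewrite dotDr; congr (_ + _); rewrite dotDr dotZr dotNr mulrN mulNr.
  by rewrite (dotC w (_ *m M)) dot_mulmx.
have a12t : `|a1 - a2| < t := le_lt_trans a12 hk_lt.
have s1b : `|s1 - b| < t by rewrite distrC (le_lt_trans bs1).
(* Each term is nonnegative: where [a1_i >= t], also [a2_i > 0], hence [b_i = s1_i = 0]; elsewhere
   [w_i = 0], or [s1_i = 0] and [w_i >= 0]. The bound on [dot (a2 - a1) g] exchanges the roles of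
   [a] and [s]. *)
have wb0 : 0 <= dot w (b - s1).
  apply: sumr_ge0 => i _; have [a2i bi abi] := a2sol i; rewrite -/b in bi abi.
  have -> : (b - s1) 0 i = b 0 i - s1 0 i by rewrite [LHS]mxE [X in _ + X]mxE.
  case: (comp i) => [[/(entry_gt0_near a12t) a2_gt0 -> gi]|[_ _ ->]|[_ -> _ wi]].
  - by move/eqP: abi; rewrite mulf_eq0 gt_eqF // => /eqP ->; rewrite subrr mulr0.
  - by rewrite mul0r.
  - by rewrite subr0 mulr_ge0.
have ag0 : dot (a2 - a1) g <= 0.
  apply: sumr_le0 => i _; have [a2i bi abi] := a2sol i; rewrite -/b in bi abi.
  have -> : (a2 - a1) 0 i = a2 0 i - a1 0 i by rewrite [LHS]mxE [X in _ + X]mxE.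
  case: (comp i) => [[_ _ ->]|[-> /(entry_gt0_near s1b) b_gt0 _]|[-> _ gi _]].
  - by rewrite mulr0.
  - move/eqP: abi; rewrite mulf_eq0 (gt_eqF b_gt0) orbF => /eqP ->.
    by rewrite subrr mul0r.
  - by rewrite subr0 mulr_ge0_le0.
move: wb0; rewrite wb leNgt => /negP; apply.
rewrite -addrA mulNr addrC subr_lt0.
apply: le_lt_trans (lerD ag0 (le_trans (ler_norm _) eE)) _.
by rewrite add0r ltr_pM2l.
Qed.
End Equivalence.

(** * Continuous differentiability implies strict differentiability *)

Section MeanValue.
Local Open Scope classical_set_scope.
Variable R : realType.

Lemma entry_diff n (i : 'I_n) (x : 'rV[R]_n) :
  is_diff x (fun y : 'rV[R]_n => y 0 i) (fun y => y 0 i).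
Proof.
pose g (y : 'rV[R]_n) : R := y 0 i.
have glin : linear g by move=> a u v; rewrite /g !mxE.
pose glM := GRing.isLinear.Build _ _ _ _ _ glin.
pose gL : {linear 'rV[R]_n -> R} := HB.pack g glM.
split; first exact: differentiable_coord.
apply: (@diff_lin _ _ _ gL); exact: coord_continuous.
Qed.

Lemma diff_jacobian m n (g : 'rV[R]_m -> 'rV[R]_n) x v :
  'd g x v = v *m 'J g x.
Proof. by rewrite mul_rV_lin1. Qed.

Lemma entry_along_line_derive m n (g : 'rV[R]_m -> 'rV[R]_n) x v i s :
  differentiable g (s *: v + x) ->
  is_derive s 1 (fun s : R => g (s *: v + x) 0 i) ((v *m 'J g (s *: v + x)) 0 i).
Proof.
move=> dg.
have d1 : is_diff s (fun s : R => s *: v + x) ( *:%R ^~ v).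
  rewrite -[X in is_diff_def _ _ X](addr0 ( *:%R ^~ v : R -> _)).
  have h := is_diffD (is_diff_scalel s v) (is_diff_cst x s).
  exact: h.
have d2 := @is_diff_comp _ _ _ _ _ _ _ _ s d1 (differentiableP dg).
have d3 := @is_diff_comp _ _ _ _ _ _ _ _ s d2 (@entry_diff n i (g (s *: v + x))).
have df := @ex_diff _ _ _ _ _ _ _ d3.
split; first exact: diff_derivable.
have := @diff_val _ _ _ _ _ _ _ d3.
rewrite deriveE // => -> /=.
by rewrite scale1r diff_jacobian.
Qed.

(** The mean value theorem is applied to each entry separately; the intermediate point may depend on
    the entry, since the sup norm is estimated entrywise. *)
Lemma cont_diff_strict m n (g : 'rV[R]_m -> 'rV[R]_n) x0 : cont_diff g ->
  forall d : R, 0 < d -> exists2 r : R, 0 < r & forall x1 x2,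
    `|x1 - x0| <= r -> `|x2 - x0| <= r ->
    `|g x1 - g x2 - (x1 - x2) *m 'J g x0| <= d * `|x1 - x2|.
Proof.
move=> [dg cJ] d d0.
(* The divisor absorbs the factor [m] from [mulmx_norm_le]. *)
have d1 : 0 < d / m.+1%:R by rewrite divr_gt0.
have /nbhs_ballP[r /= r0 rJ] : \forall x \near x0, `|'J g x0 - 'J g x| < d / m.+1%:R.
  by move/cvgrPdist_lt : (cJ x0); apply.
exists (r / 2); first exact: divr_gt0.
move=> x1 x2 x1r x2r; apply: norm_le_entries => [|j i].
  by rewrite mulr_ge0 // ltW.
rewrite (ord1 j) {j}; pose v := x1 - x2.
have dphi s := @entry_along_line_derive m n g x2 v i s (dg (s *: v + x2)).
have [|c] := @MVT_segment R (fun s : R => g (s *: v + x2) 0 i)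
    (fun s => (v *m 'J g (s *: v + x2)) 0 i) 0 1 ler01 (fun s _ => dphi s).
  apply: continuous_subspaceT => s; apply: differentiable_continuous.
  apply/derivable1_diffP; exact: ex_derive.
rewrite scale1r scale0r add0r subrK subr0 mulr1 in_itv /= => /andP[c0 c1] gv.
have -> : (g x1 - g x2 - (x1 - x2) *m 'J g x0) 0 i =
    (v *m ('J g (c *: v + x2) - 'J g x0)) 0 i.
  rewrite mulmxBr.
  have E (y z : 'rV[R]_n) : (y - z) 0 i = y 0 i - z 0 i.
    by rewrite [LHS]mxE [X in _ + X]mxE.
  by rewrite !E gv.
(* The intermediate point is a convex combination of [x1] and [x2]. *)
have cr : `|c *: v + x2 - x0| <= r / 2.
  have -> : c *: v + x2 - x0 = c *: (x1 - x0) + (1 - c) *: (x2 - x0).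
    by apply/rowP => k; rewrite !mxE; ring.
  rewrite (le_trans (ler_normD _ _)) // !normrZ ger0_norm // ger0_norm ?subr_ge0 //.
  nra.
have /rJ : ball x0 r (c *: v + x2).
  rewrite -ball_normE /= distrC (le_lt_trans cr) //.
  by rewrite ltr_pdivrMr // mulr_natr mulr2n ltrDr.
rewrite distrC => /ltW Jr.
apply: le_trans (entry_le_norm _ _ _) _; apply: le_trans (mulmx_norm_le _ _) _.
rewrite ler_wpM2r // (le_trans (ler_wpM2l _ Jr)) //.
by rewrite mulrCA ger_pMr // ler_pdivrMr // mul1r ler_nat.
Qed.

End MeanValue.

(** * Invariance under change of norm and of linear coordinates *)

Section Transfer.
Local Open Scope classical_set_scope.
Variable R : realType.

Lemma aubin_lip_like m n (S : 'rV[R]_m -> set 'rV[R]_n) p0 x0 :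
  aubin S p0 x0 <-> lip_like S p0 x0.
Proof.
have em q (x : 'rV[R]_q) := enorm_le_norm x.
have me q (x : 'rV[R]_q) := norm_le_enorm x.
split=> -[k [r [k0 r0 lip]]].
  (* One factor that compares the norms in both spaces, so a single radius serves. *)
  pose N : R := (maxn m n).+1%:R.
  have [mN nN] : m.+1%:R <= N /\ n.+1%:R <= N.
    by rewrite !ler_nat !ltnS leq_maxl leq_maxr.
  have N0 : 0 < N by [].
  have ball q (x : 'rV[R]_q) : q.+1%:R <= N -> `|x| <= r / N -> enorm x <= r.
    move=> qN; rewrite ler_pdivlMr // mulrC; apply: le_trans.
    by apply: le_trans (em _ _) _; rewrite ler_wpM2r.
  exists (k * m.+1%:R), (r / N); split; [exact: mulr_gt0|exact: divr_gt0|].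
  move=> p1 p2 x1 p1r p2r Sx1 x1r.
  have [|||x Sx [w w1 wx]] := lip p1 p2 _ _ x1.
  - exact: ball.
  - exact: ball.
  - by split=> //; exact: ball.
  exists x => //; rewrite -wx addrAC subrr add0r normrZ.
  rewrite /eball /= subr0 in w1.
  have h : 0 <= k * enorm (p1 - p2) by rewrite mulr_ge0 ?enorm_ge0 // ltW.
  rewrite ger0_norm //; apply: le_trans (_ : k * enorm (p1 - p2) <= _).
    by rewrite ler_piMr // (le_trans (me _ _)).
  by rewrite -mulrA ler_pM2l.
exists (k * n.+1%:R), r; split=> //; first exact: mulr_gt0.
move=> p1 p2 p1r p2r x1 [Sx1 x1r].
have [x Sx x12] := lip p1 p2 x1 (le_trans (me _ _) p1r) (le_trans (me _ _) p2r)
  Sx1 (le_trans (me _ _) x1r).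
(* For equal parameters the scaling factor vanishes and [x1 = x]; otherwise the vector of the unit
   ball is [x1 - x] divided by the factor. *)
exists x => //; have [p12|p12] := eqVneq p1 p2.
  exists 0; first by rewrite /eball /= subrr /enorm dot0l sqrtr0.
  rewrite scaler0 addr0; apply/esym/eqP; rewrite -subr_eq0 -normr_le0.
  by rewrite (le_trans x12) // p12 subrr normr0 mulr0.
have e0 : 0 < enorm (p1 - p2).
  by rewrite (lt_le_trans _ (me _ _)) // normr_gt0 subr_eq0.
set c := k * n.+1%:R * enorm (p1 - p2).
have h0 : 0 < c by rewrite !mulr_gt0.
exists (c^-1 *: (x1 - x)).
  rewrite /eball /= subr0 /enorm dotZl dotZr mulrA -expr2 sqrtrM ?sqr_ge0 //.
  rewrite sqrtr_sqr ger0_norm; last by rewrite invr_ge0 ltW.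
  rewrite ler_pdivrMl // mulr1 /c.
  apply: le_trans (em _ _) _; rewrite (mulrC k) -mulrA ler_pM2l //.
  by apply: le_trans x12 _; rewrite ler_pM2l.
by rewrite scalerA divff ?gt_eqF // scale1r addrC subrK.
Qed.

Lemma lip_like_mulmx m n (S T : 'rV[R]_m -> set 'rV[R]_n) (A B : 'M[R]_n) p0 x0 :
  A *m B = 1%:M -> (forall p x, S p x <-> T p (x *m A)) ->
  lip_like T p0 (x0 *m A) -> lip_like S p0 x0.
Proof.
move=> AB ST [k [r [k0 r0 lip]]].
have BA := mulmx1C AB.
have [kA kA0 hA] := mulmx_bound A; have [kB kB0 hB] := mulmx_bound B.
exists (kB * k), (Num.min r (r / kA)); split.
- exact: mulr_gt0.
- by rewrite lt_min r0 divr_gt0.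
move=> p1 p2 x1; rewrite !le_min => /andP[p1r _] /andP[p2r _].
move=> /ST Tx1 /andP[_]; rewrite ler_pdivlMr // mulrC => x1r.
have [|a2 Ta2 xa] := lip p1 p2 _ p1r p2r Tx1.
  by rewrite -mulmxBl (le_trans (hA _)).
exists (a2 *m B); first by apply/ST; rewrite -mulmxA BA mulmx1.
have -> : x1 - a2 *m B = (x1 *m A - a2) *m B by rewrite mulmxBl -mulmxA AB mulmx1.
by rewrite (le_trans (hB _)) // -mulrA ler_pM2l.
Qed.

(** The chain rule with linear maps on both sides; for row vectors the inner map multiplies the
    derivative from the left. *)
Lemma strict_diff2_mulmx m n k l (f : 'rV[R]_m -> 'rV[R]_n -> 'rV[R]_k)
    p0 a0 P M (B : 'M[R]_n) (C : 'M[R]_(k, l)) :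
  strict_diff2 f p0 (a0 *m B) P M ->
  strict_diff2 (fun p a => f p (a *m B) *m C) p0 a0 (P *m C) (B *m M *m C).
Proof.
move=> sf d d0.
have [kB kB0 hB] := mulmx_bound B; have [kC kC0 hC] := mulmx_bound C.
have [|r r0 fr] := sf (d / (kC * (1 + kB))).
  by rewrite divr_gt0 // mulr_gt0 // addr_gt0.
exists (Num.min r (r / kB)); first by rewrite lt_min r0 divr_gt0.
move=> p1 p2 a1 a2; rewrite !le_min !(ler_pdivlMr _ _ kB0).
move=> /andP[p1r _] /andP[p2r _] /andP[_ a1r] /andP[_ a2r].
have Br a : `|a - a0| * kB <= r -> `|a *m B - a0 *m B| <= r.
  by rewrite mulrC -mulmxBl; exact: le_trans.
have := fr p1 p2 (a1 *m B) (a2 *m B) p1r p2r (Br _ a1r) (Br _ a2r).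
rewrite -mulmxBl => h.
rewrite !mulmxA -mulmxBl -mulmxDl -mulmxBl; apply: le_trans (hC _) _.
rewrite -ler_pdivlMl //; apply: le_trans h _.
have kB1 : 0 < 1 + kB by rewrite addr_gt0.
rewrite invfM mulrA [d / kC]mulrC -!mulrA ler_pM2l ?invr_gt0 // ler_pM2l //.
rewrite ler_pdivrMl // mulrDl mulrDr.
have := hB (a1 - a2); have := mulr_ge0 (ltW kB0) (normr_ge0 (p1 - p2)).
have := normr_ge0 (a1 - a2); lra.
Qed.

End Transfer.

(** * Partial Jacobians as blocks of the full Jacobian *)

Section Parametrized.
Local Open Scope classical_set_scope.
Variables (R : realType) (m n : nat) (F : 'rV[R]_m -> 'rV[R]_n -> 'rV[R]_n).
Hypothesis hF : cont_diff2 F.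
Let G (z : 'rV[R]_(m + n)) := F (lsubmx z) (rsubmx z).

Let FE p x : F p x = G (row_mx p x).
Proof. by rewrite /G row_mxKl row_mxKr. Qed.

(** The slice is [G] after an affine insertion. Rows of the Jacobian belong to input coordinates, so
    the derivative in [p] is the upper block, and the one in [x] the lower. *)
Lemma slice_p_diff p x :
  is_diff p (F ^~ x) (fun q => q *m usubmx ('J G (row_mx p x))).
Proof.
pose A : 'M[R]_(m, m + n) := row_mx 1%:M 0.
pose c : 'rV[R]_(m + n) := row_mx 0 x.
have E q : q *m A + c = row_mx q x.
  by rewrite mul_mx_row mulmx1 mulmx0 add_row_mx addr0 add0r.
have dG : is_diff (p *m A + c) G ('d G (p *m A + c)).
  by apply: differentiableP; exact: (proj1 hF).
have := @is_diff_comp _ _ _ _ _ _ _ _ p (affine_mx_diff A c p) dG.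
congr (@is_diff_def _ _ _ _ _ _ _).
  by apply/funext => q /=; rewrite E FE.
apply/funext => q /=; rewrite diff_jacobian E.
by rewrite -[in LHS](vsubmxK ('J G _)) mul_mx_row mulmx1 mulmx0 mul_row_col mul0mx addr0.
Qed.

Lemma slice_x_diff p x :
  is_diff x (F p) (fun y => y *m dsubmx ('J G (row_mx p x))).
Proof.
pose A : 'M[R]_(n, m + n) := row_mx 0 1%:M.
pose c : 'rV[R]_(m + n) := row_mx p 0.
have E y : y *m A + c = row_mx p y.
  by rewrite mul_mx_row mulmx1 mulmx0 add_row_mx addr0 add0r.
have dG : is_diff (x *m A + c) G ('d G (x *m A + c)).
  by apply: differentiableP; exact: (proj1 hF).
have := @is_diff_comp _ _ _ _ _ _ _ _ x (affine_mx_diff A c x) dG.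
congr (@is_diff_def _ _ _ _ _ _ _).
  by apply/funext => y /=; rewrite E FE.
apply/funext => y /=; rewrite diff_jacobian E.
by rewrite -[in LHS](vsubmxK ('J G _)) mul_mx_row mulmx1 mulmx0 mul_row_col mul0mx add0r.
Qed.

Lemma jac_pE p x : jac_p F p x = usubmx ('J G (row_mx p x)).
Proof.
apply/row_matrixP => i; rewrite !rowE /jac_p -diff_jacobian.
by rewrite (@diff_val _ _ _ _ _ _ _ (slice_p_diff p x)).
Qed.

Lemma jac_xE p x : jac_x F p x = dsubmx ('J G (row_mx p x)).
Proof.
apply/row_matrixP => i; rewrite !rowE /jac_x -diff_jacobian.
by rewrite (@diff_val _ _ _ _ _ _ _ (slice_x_diff p x)).
Qed.

Lemma slice_p_continuous x : continuous (F ^~ x).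
Proof.
move=> p; apply: differentiable_continuous.
exact: (@ex_diff _ _ _ _ _ _ _ (slice_p_diff p x)).
Qed.

Lemma slice_x_continuous p : continuous (F p).
Proof.
move=> x; apply: differentiable_continuous.
exact: (@ex_diff _ _ _ _ _ _ _ (slice_x_diff p x)).
Qed.

Lemma cont_diff2_strict p x : strict_diff2 F p x (jac_p F p x) (jac_x F p x).
Proof.
move=> d d0; have [r r0 Gr] := @cont_diff_strict R _ _ G (row_mx p x) hF d d0.
exists r => // p1 p2 x1 x2 p1r p2r x1r x2r.
have B q1 q2 (y1 y2 : 'rV[R]_n) :
    row_mx q1 y1 - row_mx q2 y2 = row_mx (q1 - q2) (y1 - y2) :> 'rV[R]_(m + n).
  by rewrite opp_row_mx add_row_mx.
have := Gr (row_mx p1 x1) (row_mx p2 x2).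
rewrite !B !row_mx_norm !ge_max p1r p2r x1r x2r => /(_ isT isT).
rewrite -!FE -[X in _ *m X]vsubmxK mul_row_col -jac_pE -jac_xE => h.
apply: le_trans h _; rewrite ler_pM2l // ge_max.
by rewrite lerDl normr_ge0 lerDr normr_ge0.
Qed.

End Parametrized.

(** * The complementarity system in coordinates of the cone *)

Section DualCoordinates.
Local Open Scope classical_set_scope.
Variables (R : realType) (n : nat) (b u : 'I_n -> 'rV[R]_n).
Hypothesis hu : dual_system b u.
(** [x *m A] is the coordinate vector of [x] in the basis [b], and [y *m B^T] collects the products
    [<y, b_i>]. The minus sign in [A] compensates for the one in [dual_system]. *)
Let B : 'M[R]_n := \matrix_i b i.
Let A : 'M[R]_n := - (\matrix_i u i)^T.

Lemma dual_mulmx : A *m B = 1%:M.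
Proof.
apply: mulmx1C; apply/matrixP => i j; rewrite mulmxN !mxE.
transitivity (- dot (u j) (b i)).
  by congr (- _); apply: eq_bigr => k _; rewrite !mxE mulrC.
by rewrite hu opprK.
Qed.

Lemma entry_mul_dual (v : 'rV[R]_n) i : (v *m A) 0 i = - dot v (u i).
Proof.
rewrite mulmxN mxE mxE; congr (- _).
by apply: eq_bigr => k _; rewrite !mxE.
Qed.

Lemma entry_mul_tr (v : 'rV[R]_n) i : (v *m B^T) 0 i = dot v (b i).
Proof. by rewrite mxE; apply: eq_bigr => k _; rewrite !mxE. Qed.

Lemma cone_mulmx x : cone b x <-> forall i, 0 <= (x *m A) 0 i.
Proof.
have sumE (a : 'I_n -> R) : \sum_i a i *: b i = (\row_i a i) *m B.
  by rewrite mulmx_sum_row; apply: eq_bigr => i _; rewrite mxE rowK.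
split=> [[a a0 ->] i|x0]; first by rewrite sumE -mulmxA (mulmx1C dual_mulmx) mulmx1 mxE.
exists (fun i => (x *m A) 0 i) => //.
rewrite sumE (_ : \row_i _ = x *m A) -?mulmxA ?dual_mulmx ?mulmx1 //.
by apply/rowP => i; rewrite mxE.
Qed.

(** The polar condition need only be tested on the generators. *)
Lemma polar_cone_mulmx y : polar (cone b) (- y) <-> forall i, 0 <= (y *m B^T) 0 i.
Proof.
split=> [yp i|y0 x /cone_mulmx x0].
  rewrite entry_mul_tr -oppr_le0 -dotNl; apply: yp; apply/cone_mulmx => j.
  rewrite entry_mul_dual dotC hu opprK; exact: ler0n.
rewrite dotNl oppr_le0 -[x]mulmx1 -dual_mulmx mulmxA dotC dot_mulmx.
by apply: sumr_ge0 => i _; rewrite mulr_ge0.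
Qed.

(** [<x, F p x>] is the sum of the products of both coordinate vectors; its terms are nonnegative,
    so it vanishes only if each term does. *)
Lemma solution_map_ncp m (F : 'rV[R]_m -> 'rV[R]_n -> 'rV[R]_n) p x :
  solution_map F (cone b) p x <->
  ncp (fun p a => F p (a *m B) *m B^T) p (x *m A).
Proof.
have dotE : dot x (F p x) = dot (x *m A) (F p x *m B^T).
  by rewrite -dot_mulmx -mulmxA dual_mulmx mulmx1.
rewrite /ncp /= -mulmxA dual_mulmx mulmx1; split.
  move=> [/cone_mulmx x0 /polar_cone_mulmx y0]; rewrite dotE => /eqP.
  rewrite psumr_eq0 => [/allP xy i|i _]; last exact: mulr_ge0.
  by split=> //; apply/eqP/xy/mem_index_enum.
move=> xy; split; [apply/cone_mulmx|apply/polar_cone_mulmx|].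
- by move=> i; have [] := xy i.
- by move=> i; have [] := xy i.
by rewrite dotE; apply: big1 => i _; have [] := xy i.
Qed.

End DualCoordinates.

(** * The index sets as sign conditions on the coordinates *)

Section IndexSets.
Local Open Scope classical_set_scope.
Variables (R : realType) (n : nat) (b u : 'I_n -> 'rV[R]_n).
Hypothesis hu : dual_system b u.
Variables (z a0 s0 : 'rV[R]_n).
Hypothesis a0_ge0 : forall i, 0 <= a0 0 i.
Hypothesis s0_ge0 : forall i, 0 <= s0 0 i.
Hypothesis a0s0 : forall i, a0 0 i * s0 0 i = 0.
Hypothesis zE : z = \sum_i a0 0 i *: b i + \sum_i s0 0 i *: u i.

Lemma index_rep_support : index_rep b u z [set i | 0 < s0 0 i]%SET (a0 0) (s0 0).
Proof.
split=> [|j|i _ //]; last by rewrite inE.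
rewrite zE (bigID (mem [set i | 0 < s0 0 i]%SET)) /= big1 ?add0r => [|i].
  congr (_ + _); rewrite [LHS](bigID (mem [set i | 0 < s0 0 i]%SET)) /=.
  rewrite [X in _ + X]big1 ?addr0 // => i.
  rewrite inE => si; suff -> : s0 0 i = 0 by rewrite scale0r.
  by apply/eqP; rewrite eq_le s0_ge0 leNgt si.
rewrite inE => si; move/eqP: (a0s0 i).
by rewrite mulf_eq0 (gt_eqF si) orbF => /eqP ->; rewrite scale0r.
Qed.

Lemma dual_decomposition_unique (a c : 'I_n -> R) :
  (forall i, 0 <= a i) -> (forall i, 0 <= c i) -> (forall i, a i * c i = 0) ->
  z = \sum_i a i *: b i + \sum_i c i *: u i ->
  forall i, a i = a0 0 i /\ c i = s0 0 i.
Proof.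
move=> a_ge0 c_ge0 ac zac.
have bu i (f : 'I_n -> R) : dot (\sum_j f j *: u j) (b i) = - f i.
  rewrite dot_suml (bigD1 i) //= dotZl hu eqxx mulrN1 big1 ?addr0 // => j ji.
  by rewrite dotZl hu eq_sym (negPf ji) oppr0 mulr0.
have ub j (f : 'I_n -> R) : dot (\sum_i f i *: b i) (u j) = - f j.
  rewrite dot_suml (bigD1 j) //= dotZl dotC hu eqxx mulrN1 big1 ?addr0 // => i ij.
  by rewrite dotZl dotC hu (negPf ij) oppr0 mulr0.
pose x := \sum_i (a i - a0 0 i) *: b i.
have xE : x = \sum_i (s0 0 i - c i) *: u i.
  rewrite /x; under eq_bigr do rewrite scalerBl.
  under [RHS]eq_bigr do rewrite scalerBl.
  by rewrite !sumrB; apply/eqP; rewrite subr_eq addrAC eq_sym subr_eq addrC -zE zac addrC.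
(* [<x, x> = - sum (a_i s0_i + a0_i c_i)]: uniqueness in Moreau's decomposition. *)
have xx : dot x x <= 0.
  rewrite {1}/x dot_suml; apply: sumr_le0 => i _.
  rewrite dotZl dotC xE bu.
  have := a0s0 i; have := ac i.
  have := mulr_ge0 (a_ge0 i) (s0_ge0 i); have := mulr_ge0 (a0_ge0 i) (c_ge0 i).
  lra.
have x0 : x = 0 by apply: dot_eq0; apply/eqP; rewrite eq_le xx dot_ge0.
move=> i; have /esym/eqP := ub i (fun i => a i - a0 0 i).
have /esym/eqP := bu i (fun i => s0 0 i - c i).
by rewrite -xE -/x x0 !dot0l !oppr_eq0 !subr_eq0 => /eqP -> /eqP ->.
Qed.

(** Setting [a] to 0 on [I] and [c] to 0 outside turns a representation into a complementary
    decomposition, which is unique. *)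
Lemma index_rep_coordinates I a c i : index_rep b u z I a c ->
  if i \in I then a0 0 i = 0 /\ 0 < s0 0 i else a i = a0 0 i /\ s0 0 i = 0.
Proof.
case=> zI cI aI.
have [||||<- <-] := @dual_decomposition_unique
    (fun i => if i \notin I then a i else 0) (fun i => if i \in I then c i else 0) _ _ _ _ i.
- by move=> j; case: ifP => // /aI.
- by move=> j; case: ifP => // /cI/ltW.
- by move=> j; case: ifP => //=; rewrite ?mul0r // => /negPf ->; rewrite mulr0.
- rewrite zI; congr (_ + _); rewrite big_mkcond; apply: eq_bigr => j _.
    by case: ifP => //; rewrite scale0r.
  by case: ifP => //; rewrite scale0r.
by have [iI|//] := boolP (i \in I); split => //; exact: cI.
Qed.

Lemma in_Iplus i : (i \in Iplus b u z) = (0 < a0 0 i).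
Proof.
rewrite inE; apply/asboolP/idP => [[I [a [c [zI iI ai]]]]|ai].
  by have := index_rep_coordinates i zI; rewrite (negPf iI) => -[<-].
exists [set i | 0 < s0 0 i]%SET, (a0 0), (s0 0); split=> //.
  exact: index_rep_support.
rewrite inE -leNgt; move/eqP: (a0s0 i).
by rewrite mulf_eq0 (gt_eqF ai) /= => /eqP ->.
Qed.

Lemma in_Iminus i : (i \in Iminus b u z) = (0 < s0 0 i).
Proof.
rewrite inE; apply/asboolP/idP => [[I [a [c [zI iI]]]]|si].
  by have := index_rep_coordinates i zI; rewrite iI => -[].
exists [set i | 0 < s0 0 i]%SET, (a0 0), (s0 0).
by split; [exact: index_rep_support|rewrite inE].
Qed.

Lemma in_Ibullet i :
  (i \in Ibullet b u z) = ~~ (0 < a0 0 i) && ~~ (0 < s0 0 i).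
Proof.
rewrite inE; apply/asboolP/idP => [[I [a [c [zI iI ai]]]]|/andP[ai si]].
  have := index_rep_coordinates i zI; rewrite (negPf iI) ai => -[<- ->].
  by rewrite ltxx.
exists [set i | 0 < s0 0 i]%SET, (a0 0), (s0 0); split=> //.
- exact: index_rep_support.
- by rewrite inE.
by apply/eqP; rewrite eq_le a0_ge0 leNgt ai.
Qed.

End IndexSets.

(** * The index condition translated into multipliers *)

Theorem theorem4p6 (R : realType) (m n : nat) (hn : (0 < n)%N)
  (b u : 'I_n -> 'rV[R]_n) (hb : lin_indep b) (hu : dual_system b u)
  (hK : isotone_projection (cone b))
  (F : 'rV[R]_m -> 'rV[R]_n -> 'rV[R]_n) (hF : cont_diff2 F)
  (pbar : 'rV[R]_m) (xbar : 'rV[R]_n)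
  (hS : solution_map F (cone b) pbar xbar)
  (hsurj : forall w : 'rV[R]_n, exists q : 'rV[R]_m,
     q *m jac_p F pbar xbar = w) :
  let z := xbar - F pbar xbar in
  let Ip := Iplus b u z in
  let Im := Iminus b u z in
  let Ib := Ibullet b u z in
  aubin (solution_map F (cone b)) pbar xbar <->
  (forall I J : {set 'I_n}, I \subset Ib -> J \subset Ib -> [disjoint I & J] ->
   forall v : 'rV[R]_n,
     (forall i, i \in Ip :|: I -> dot (v *m (jac_x F pbar xbar)^T) (b i) = 0) ->
     (forall i, i \in Ib :\: (I :|: J) ->
        dot (v *m (jac_x F pbar xbar)^T) (b i) <= 0 /\ dot v (u i) <= 0) ->
     (forall i, i \in Im :|: J -> dot v (u i) = 0) ->
     v = 0).
Proof.
move=> z Ip Im Ib.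
pose B : 'M[R]_n := \matrix_i b i; pose U : 'M[R]_n := \matrix_i u i.
pose A : 'M[R]_n := - U^T.
have AB : A *m B = 1%:M := dual_mulmx hu.
have BA := mulmx1C AB.
have abarB : xbar *m A *m B = xbar by rewrite -mulmxA AB mulmx1.
pose f p a := F p (a *m B) *m B^T.
pose abar := xbar *m A; pose sbar := f pbar abar.
have sbarE : sbar = F pbar xbar *m B^T by rewrite /sbar /f abarB.
pose P := jac_p F pbar xbar *m B^T.
pose M := B *m jac_x F pbar xbar *m B^T.
have sol : ncp f pbar abar by exact/solution_map_ncp.
have sf : strict_diff2 f pbar abar P M.
  by apply: strict_diff2_mulmx; rewrite abarB; exact: cont_diff2_strict.
have cfx p : continuous (f p).
  move=> a; have cFx := @slice_x_continuous R m n F hF p (a *m B).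
  have c1 := continuous_comp (@mulmx_continuous R _ _ B a) cFx.
  exact: (continuous_comp c1 (@mulmx_continuous R _ _ B^T _)).
have cfp a : continuous (f ^~ a).
  move=> p; have c1 := @slice_p_continuous R m n F hF (a *m B) p.
  exact: (continuous_comp c1 (@mulmx_continuous R _ _ B^T _)).
have BAT : B^T *m A^T = 1%:M by rewrite -trmx_mul AB trmx1.
(* The rows of [Q] are preimages of the rows of [A^T] under the surjective partial derivative, and
   [A^T] is inverse to [B^T]. *)
have [Q QP] : exists Q : 'M[R]_(n, m), Q *m P = 1%:M.
  have /choice[q qP] := hsurj.
  exists (\matrix_i q (row i A^T)).
  rewrite mulmxA (_ : _ *m jac_p F pbar xbar = A^T) ?(mulmx1C BAT) //.
  by apply/row_matrixP => i; rewrite row_mul rowK qP.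
have sumE (c : 'rV[R]_n) (g : 'I_n -> 'rV[R]_n) :
    \sum_i c 0 i *: g i = c *m \matrix_i g i.
  by rewrite mulmx_sum_row; apply: eq_bigr => i _; rewrite rowK.
(* Since [F pbar xbar = sbar *m A^T] and the rows of [- A^T] are the [u i], this is the Moreau
   decomposition of [z]. *)
have zE : z = \sum_i abar 0 i *: b i + \sum_i sbar 0 i *: u i.
  rewrite !sumE abarB sbarE (_ : \matrix_i u i = - A^T).
    by rewrite mulmxN -mulmxA BAT mulmx1.
  by rewrite /A linearN /= trmxK opprK.
have a_ge0 i : 0 <= abar 0 i by have [] := sol i.
have s_ge0 i : 0 <= sbar 0 i by have [] := sol i.
have as0 i : abar 0 i * sbar 0 i = 0 by have [] := sol i.
have inIp i : (i \in Ip) = (0 < abar 0 i) by apply: in_Iplus zE _.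
have inIm i : (i \in Im) = (0 < sbar 0 i) by apply: in_Iminus zE _.
have inIb i : (i \in Ib) = ~~ (0 < abar 0 i) && ~~ (0 < sbar 0 i).
  by apply: in_Ibullet zE _.
clearbody Ip Im Ib.
(* The premises on [v] become conditions on the multiplier [w = v *m A]. *)
have gE v i : dot (v *m (jac_x F pbar xbar)^T) (b i) = (v *m A *m M^T) 0 i.
  rewrite -entry_mul_tr; congr (_ 0 i).
  by rewrite !trmx_mul trmxK !mulmxA -(mulmxA v A) AB mulmx1.
have wE v i : dot v (u i) = - (v *m A) 0 i by rewrite entry_mul_dual opprK.
rewrite aubin_lip_like; transitivity (no_multiplier abar sbar M).
  have ST p x : solution_map F (cone b) p x <-> ncp f p (x *m A) by exact: solution_map_ncp.
  split=> [lip|nm].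
    apply: (lip_like_no_multiplier sf QP cfp sol).
    apply: (lip_like_mulmx (A := B) (B := A) BA _ (_ : lip_like _ pbar (abar *m B))).
      by move=> p a; apply: iff_sym; apply: iff_trans (ST p _) _; rewrite -mulmxA BA mulmx1.
    by rewrite abarB.
  exact: (lip_like_mulmx AB ST (ncp_lip_like sf cfx sol nm)).
split=> [nm I J IIb JIb IJ v hI hIJ hJ|nm w wa ws wb].
  suff w0 : v *m A = 0 by rewrite -[v]mulmx1 -AB mulmxA w0 mul0mx.
  apply: nm => i.
  - by move=> ai; rewrite -gE hI // inE inIp ai.
  - by move=> si; apply: oppr_inj; rewrite -wE hJ ?oppr0 // inE inIm si.
  - move=> ai si; have iIb : i \in Ib by rewrite inIb ai.
    have [iI|iI] := boolP (i \in I); first by constructor 1; rewrite -gE hI // inE iI orbT.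
    have [iJ|iJ] := boolP (i \in J).
      by constructor 2; apply: oppr_inj; rewrite -wE hJ ?oppr0 // inE iJ orbT.
    have [|gi wi] := hIJ i; first by rewrite !inE iIb negb_or iI iJ.
    by constructor 3; rewrite -gE -oppr_le0 -wE.
have wBA : w *m B *m A = w by rewrite -mulmxA BA mulmx1.
suff : w *m B = 0 by move=> wB0; rewrite -wBA wB0 mul0mx.
(* [I] and [J] record which alternative holds; an index satisfying both equations goes to [I], for
   disjointness, and the others satisfy the sign conditions. *)
pose I := [set i in Ib | (w *m M^T) 0 i == 0]%SET.
pose J := [set i in Ib | (w 0 i == 0) && (i \notin I)]%SET.
apply: (nm I J).
- by apply/fintype.subsetP => i; rewrite inE => /andP[].
- by apply/fintype.subsetP => i; rewrite inE => /andP[].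
- rewrite -finset.setI_eq0; apply/eqP/finset.setP => i; rewrite !inE.
  by case: (i \in Ib) => //=; case: (_ == 0) => //=; rewrite andbF.
- move=> i; rewrite !inE inIp gE wBA => /orP[/wa //|/andP[_ /eqP //]].
- move=> i; rewrite !inE gE wE wBA inIb => /andP[h1 /andP[ai si]].
  move: h1; rewrite ai si /=.
  have [gi|gi0|[gi wi]] := wb i ai si.
  + by rewrite gi eqxx.
  + by rewrite gi0 eqxx; case: (_ == 0).
  + by rewrite oppr_le0.
- move=> i; rewrite !inE inIm wE wBA => /orP[/ws ->|]; first by rewrite oppr0.
  by move=> /and3P[_ /eqP -> _]; rewrite oppr0.
Qed.
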